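(* Let $E$ and $F$ be Banach lattices. Each positive uaw-Dunford–Pettis operator $T:E\to F$ is weak Dunford–Pettis if one of the following holds: (1) the lattice operations in $E$ are weakly sequentially continuous; (2) $F$ is discrete with an order continuous norm; (3) $F$ has the AM-compactness property.
   Context: All operators are continuous linear operators. A net $(x_\alpha)$ in a Banach lattice $E$ is uaw-convergent to $x$ (written $x_\alpha\xrightarrow{uaw}x$) if $|x_\alpha-x|\wedge u\to 0$ weakly for every $u\in E_+$. An operator $T$ from a Banach lattice $E$ into a Banach space $X$ is uaw-Dunford–Pettis if for every norm bounded sequence $(x_n)$ in $E$ with $x_n\xrightarrow{uaw}0$ one has $\|Tx_n\|\to 0$. An operator $T:X\to Y$ between Banach spaces is weak Dunford–Pettis if $f_n(Tx_n)\to 0$ for every weakly null sequence $(x_n)$ in $X$ and every weakly null sequence $(f_n)$ in $Y'$. A Banach lattice has weakly sequentially continuous lattice operations if $x_n\to 0$ weakly implies $|x_n|\to 0$ weakly. A Banach lattice $F$ has the AM-compactness property if every weakly compact operator from $F$ into an arbitrary Banach space is AM-compact, i.e. maps order bounded subsets of $F$ to relatively norm compact sets. *)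

(* Defs.v *)
From HB Require Import structures.
From mathcomp Require Import all_boot all_order all_algebra.
From mathcomp Require Import all_classical all_reals all_analysis.
Set Implicit Arguments.
Unset Strict Implicit.
Unset Printing Implicit Defensive.
Import Order.TTheory GRing.Theory Num.Theory.
Import numFieldNormedType.Exports.
Local Open Scope classical_set_scope.
Local Open Scope ring_scope.

Definition is_functional {R : realType} {X : normedModType R} (f : X -> R) : Prop :=
  (forall (a : R) (x y : X), f (a *: x + y) = a * f x + f y) /\ continuous f.

Definition is_operator {R : realType} {X Y : normedModType R} (T : X -> Y) : Prop :=
  (forall (a : R) (x y : X), T (a *: x + y) = a *: T x + T y) /\ continuous T.

Definition weak_cvg {R : realType} {X : normedModType R} (x : nat -> X) (l : X) : Prop :=
  forall f : X -> R, is_functional f -> (fun n => f (x n)) @ \oo --> f l.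

Definition dual_bounded {R : realType} {X : normedModType R} (f : X -> R) (K : R) : Prop :=
  forall x : X, `|f x| <= K * `|x|.

(* continuous linear functionals on the Banach space X' (elements of X''):
   linear on X' and bounded w.r.t. the dual (operator) norm of X' *)
Definition is_bidual_functional {R : realType} {X : normedModType R}
    (phi : (X -> R) -> R) : Prop :=
  (forall (a : R) (f g : X -> R), is_functional f -> is_functional g ->
     phi (fun x => a * f x + g x) = a * phi f + phi g) /\
  exists C : R, 0 <= C /\
    forall (f : X -> R) (K : R), is_functional f -> 0 <= K -> dual_bounded f K ->
      `|phi f| <= C * K.

Definition weak_null_dual {R : realType} {X : normedModType R} (g : nat -> X -> R) : Prop :=
  (forall n, is_functional (g n)) /\
  forall phi, is_bidual_functional phi -> (fun n => phi (g n)) @ \oo --> (0 : R).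

Definition weak_DP {R : realType} {X Y : normedModType R} (T : X -> Y) : Prop :=
  forall (x : nat -> X) (g : nat -> Y -> R),
    weak_cvg x 0 -> weak_null_dual g -> (fun n => g n (T (x n))) @ \oo --> (0 : R).

Definition dual_sig {R : realType} (X : normedModType R) : Type :=
  {f : X -> R | is_functional f}.
Definition dual_eval {R : realType} {X : normedModType R} (x : X) :
  {ptws dual_sig X -> R} := fun f => proj1_sig f x.
Definition weak_top {R : realType} (X : normedModType R) :=
  initial_topology (@dual_eval R X).

Definition rel_weakly_compact {R : realType} {X : normedModType R} (A : set X) : Prop :=
  @compact (weak_top X) (@closure (weak_top X) A).

Definition weakly_compact_op {R : realType} {X Y : normedModType R} (T : X -> Y) : Prop :=
  rel_weakly_compact (T @` [set x : X | `|x| <= 1]).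

Definition banach_lattice_axioms {R : realType} {E : normedModType R}
    (le : E -> E -> Prop) (sup : E -> E -> E) : Prop :=
  (forall x, le x x) /\
  (forall x y, le x y -> le y x -> x = y) /\
  (forall x y z, le x y -> le y z -> le x z) /\
  (forall x y z, le x y -> le (x + z) (y + z)) /\
  (forall (a : R) x y, 0 <= a -> le x y -> le (a *: x) (a *: y)) /\
  (forall x y, le x (sup x y) /\ le y (sup x y) /\
               forall z, le x z -> le y z -> le (sup x y) z) /\
  (forall x y, le (sup x (- x)) (sup y (- y)) -> `|x| <= `|y|).

Record BanachLattice (R : realType) := {
  BL_car :> completeNormedModType R;
  BL_le : BL_car -> BL_car -> Prop;
  BL_sup : BL_car -> BL_car -> BL_car;
  BL_ax : banach_lattice_axioms BL_le BL_sup }.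

Definition bl_abs {R : realType} {E : BanachLattice R} (x : E) : E :=
  BL_sup x (- x).
Definition bl_inf {R : realType} {E : BanachLattice R} (x y : E) : E :=
  - BL_sup (- x) (- y).

Definition uaw_cvg {R : realType} {E : BanachLattice R} (x : nat -> E) (l : E) : Prop :=
  forall u : E, BL_le 0 u -> weak_cvg (fun n => bl_inf (bl_abs (x n - l)) u) 0.

Definition uaw_DP {R : realType} {E : BanachLattice R} {X : normedModType R}
    (T : E -> X) : Prop :=
  forall x : nat -> E, (exists M : R, forall n, `|x n| <= M) ->
    uaw_cvg x 0 -> (fun n => `|T (x n)|) @ \oo --> (0 : R).

Definition positive_op {R : realType} {E F : BanachLattice R} (T : E -> F) : Prop :=
  forall x : E, BL_le 0 x -> BL_le 0 (T x).

Definition weakly_seq_cont_lattice_ops {R : realType} (E : BanachLattice R) : Prop :=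
  forall x : nat -> E, weak_cvg x 0 -> weak_cvg (fun n => bl_abs (x n)) 0.

Definition is_atom {R : realType} {E : BanachLattice R} (a : E) : Prop :=
  BL_le 0 a /\ a <> 0 /\
  forall y : E, BL_le (bl_abs y) a -> exists c : R, y = c *: a.

Definition discrete_BL {R : realType} (E : BanachLattice R) : Prop :=
  forall x : E, BL_le 0 x -> x <> 0 -> exists a : E, is_atom a /\ BL_le a x.

(* order continuous norm: x_alpha decreasing to 0 implies ||x_alpha|| -> 0;
   stated for downward directed sets D of positive elements with inf D = 0 *)
Definition order_continuous_norm {R : realType} (E : BanachLattice R) : Prop :=
  forall D : set E,
    D !=set0 ->
    (forall x y, D x -> D y -> exists2 z, D z & BL_le z x /\ BL_le z y) ->
    (forall x, D x -> BL_le 0 x) ->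
    (forall l, (forall x, D x -> BL_le l x) -> BL_le l 0) ->
    forall eps : R, 0 < eps -> exists2 x, D x & `|x| < eps.

Definition AM_compact {R : realType} {E : BanachLattice R} {X : normedModType R}
    (T : E -> X) : Prop :=
  forall A : set E, (exists a b : E, A `<=` [set x | BL_le a x /\ BL_le x b]) ->
    compact (closure (T @` A)).

Definition AM_compactness_property {R : realType} (F : BanachLattice R) : Prop :=
  forall (X : completeNormedModType R) (T : F -> X),
    is_operator T -> weakly_compact_op T -> AM_compact T.

(* Main.v *)
Require Import Defs.
From HB Require Import structures.
From mathcomp Require Import all_boot all_order all_algebra.
From mathcomp Require Import all_classical all_reals all_analysis.
From mathcomp Require Import ring lra.

(**
  A disjoint bounded sequence is uaw-null, so a uaw-Dunford-Pettis operator T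
  maps it to a norm-null sequence. By a disjoint-sequence argument there is
  then, for each eps, some u >= 0 with |T (|x| - u)^+| <= eps on the unit ball.
  Given x_n weakly null, hence bounded, and f_n weakly null in F', the Riesz
  decomposition splits x_n into y_n with |y_n| <= u and a remainder which the
  positive operator T makes small; so it suffices that f_n -> 0 uniformly on
  the order interval [-Tu, Tu].
  - If F is discrete with order continuous norm, Tu is approximated in norm
    by some 0 <= w <= Tu such that f_n -> 0 uniformly on [-w, w]: multiples of
    atoms, and their sums, have this property.
  - If F has the AM-compactness property, the operator y |-> (f_n y)_n into c0
    is weakly compact (its bidual maps into c0), hence AM-compact, and a
    relatively compact subset of c0 has uniformly small tails.
  If the lattice operations of E are weakly sequentially continuous, x_n itself
  is uaw-null and |T x_n| -> 0.
*)

Set Implicit Arguments.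
Unset Strict Implicit.
Unset Printing Implicit Defensive.
Import Order.TTheory GRing.Theory Num.Theory.
Import numFieldNormedType.Exports.
Local Open Scope classical_set_scope.
Local Open Scope ring_scope.

Local Notation "x ≼ y" := (BL_le x y) (at level 70, no associativity).

(** * Banach lattices *)

Section BanachLatticeTheory.
Context {R : realType} {E : BanachLattice R}.
Implicit Types (x y z u v w a b : E) (r : R).

Lemma ble_refl x : x ≼ x.
Proof. by have [h _] := BL_ax E; apply: h. Qed.

Lemma ble_anti x y : x ≼ y -> y ≼ x -> x = y.
Proof. by have [_ [h _]] := BL_ax E; apply: h. Qed.

Lemma ble_trans y x z : x ≼ y -> y ≼ z -> x ≼ z.
Proof. by have [_ [_ [h _]]] := BL_ax E; apply: h. Qed.

Lemma bleD2r z x y : x ≼ y -> x + z ≼ y + z.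
Proof. by have [_ [_ [_ [h _]]]] := BL_ax E; apply: h. Qed.

Lemma bleD2l z x y : x ≼ y -> z + x ≼ z + y.
Proof. by rewrite ![z + _]addrC; apply: bleD2r. Qed.

Lemma bleZ r x y : 0 <= r -> x ≼ y -> r *: x ≼ r *: y.
Proof. by have [_ [_ [_ [_ [h _]]]]] := BL_ax E; apply: h. Qed.

Lemma bsup_ubl x y : x ≼ BL_sup x y.
Proof. by have [_ [_ [_ [_ [_ [h _]]]]]] := BL_ax E; have [] := h x y. Qed.

Lemma bsup_ubr x y : y ≼ BL_sup x y.
Proof. by have [_ [_ [_ [_ [_ [h _]]]]]] := BL_ax E; have [_ []] := h x y. Qed.

Lemma bsup_lub x y z : x ≼ z -> y ≼ z -> BL_sup x y ≼ z.
Proof.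
by have [_ [_ [_ [_ [_ [h _]]]]]] := BL_ax E; have [_ [_]] := h x y; apply.
Qed.

Lemma bnorm_le x y : bl_abs x ≼ bl_abs y -> `|x| <= `|y|.
Proof. by have [_ [_ [_ [_ [_ [_ h]]]]]] := BL_ax E; apply: h. Qed.

Lemma bleD a b x y : a ≼ x -> b ≼ y -> a + b ≼ x + y.
Proof. by move=> ax b_y; apply: ble_trans (bleD2r b ax) (bleD2l x b_y). Qed.

Lemma ble_subl x y z : x ≼ y + z -> x - z ≼ y.
Proof. by move=> /(bleD2r (- z)); rewrite addrK. Qed.

Lemma ble_subr x y z : x + z ≼ y -> x ≼ y - z.
Proof. by move=> /(bleD2r (- z)); rewrite addrK. Qed.

Lemma bleBl x y z : x - z ≼ y -> x ≼ y + z.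
Proof. by move=> /(bleD2r z); rewrite subrK. Qed.

Lemma bleBr x y z : x ≼ y - z -> x + z ≼ y.
Proof. by move=> /(bleD2r z); rewrite subrK. Qed.

Lemma bleN x y : x ≼ y -> - y ≼ - x.
Proof.
by move=> /(bleD2r (- x - y)); rewrite addrA subrr add0r addrCA subrr addr0.
Qed.

Lemma bsub_ge0 x y : 0 ≼ y - x -> x ≼ y.
Proof. by move=> /bleBr; rewrite add0r. Qed.

Lemma bge0_sub x y : x ≼ y -> 0 ≼ y - x.
Proof. by move=> xy; apply: ble_subr; rewrite add0r. Qed.

Lemma bleDl x y : 0 ≼ y -> x ≼ x + y.
Proof. by move=> /(bleD2l x); rewrite addr0. Qed.

Lemma bleDr x y : 0 ≼ y -> x ≼ y + x.
Proof. by rewrite addrC; apply: bleDl. Qed.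

Lemma baddr_ge0 x y : 0 ≼ x -> 0 ≼ y -> 0 ≼ x + y.
Proof. by move=> x0 y0; rewrite -[0]addr0; apply: bleD. Qed.

Lemma bscale_ge0 r x : 0 <= r -> 0 ≼ x -> 0 ≼ r *: x.
Proof. by move=> r0 /(bleZ r0); rewrite scaler0. Qed.

Lemma bsum_ge0 (I : Type) (s : seq I) (P : pred I) (f : I -> E) :
  (forall i, P i -> 0 ≼ f i) -> 0 ≼ \sum_(i <- s | P i) f i.
Proof.
move=> f0; elim/big_ind : _ => //; [exact: ble_refl | exact: baddr_ge0].
Qed.

Lemma babs_ub x : x ≼ bl_abs x. Proof. exact: bsup_ubl. Qed.

Lemma babs_ubN x : - x ≼ bl_abs x. Proof. exact: bsup_ubr. Qed.

Lemma babs_le x y : x ≼ y -> - x ≼ y -> bl_abs x ≼ y.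
Proof. exact: bsup_lub. Qed.

(** [|x| + |x|] dominates [x - x = 0], and halving preserves the order. *)
Lemma babs_ge0 x : 0 ≼ bl_abs x.
Proof.
have : 0 ≼ bl_abs x + bl_abs x.
  by rewrite -(subrr x); apply: bleD; [exact: babs_ub | exact: babs_ubN].
have h2 : 0 <= 2^-1 :> R by rewrite invr_ge0.
move=> /(bleZ h2); rewrite scaler0 -mulr2n -(scaler_nat 2 (bl_abs x)) scalerA.
by rewrite mulVf ?scale1r// pnatr_eq0.
Qed.

Lemma bge0_abs x : 0 ≼ x -> bl_abs x = x.
Proof.
move=> x0; apply: ble_anti; last exact: babs_ub.
apply: babs_le; first exact: ble_refl.
by apply: (ble_trans (y := 0)) => //; rewrite -oppr0; apply: bleN.
Qed.

Lemma babsN x : bl_abs (- x) = bl_abs x.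
Proof.
apply: ble_anti; apply: babs_le; rewrite ?opprK.
- exact: babs_ubN.
- exact: babs_ub.
- by have := babs_ubN (- x); rewrite opprK.
- exact: babs_ub.
Qed.

Lemma bnorm_absle x y : bl_abs x ≼ y -> `|x| <= `|y|.
Proof.
move=> xy; apply: bnorm_le; rewrite (bge0_abs (x := y))//.
exact: ble_trans (babs_ge0 x) xy.
Qed.

Lemma bnorm_abs x : `|bl_abs x| = `|x|.
Proof.
apply: le_anti; apply/andP; split; last exact: bnorm_absle (ble_refl _).
by apply: bnorm_le; rewrite bge0_abs; [exact: ble_refl | exact: babs_ge0].
Qed.

Lemma bnorm_mono x y : 0 ≼ x -> x ≼ y -> `|x| <= `|y|.
Proof. by move=> x0 xy; apply: bnorm_absle; rewrite bge0_abs. Qed.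

Lemma babs_triangle x y : bl_abs (x + y) ≼ bl_abs x + bl_abs y.
Proof.
apply: babs_le; first by apply: bleD; apply: babs_ub.
by rewrite opprD; apply: bleD; apply: babs_ubN.
Qed.

Definition bpos x : E := BL_sup x 0.

Lemma bpos_ge0 x : 0 ≼ bpos x. Proof. exact: bsup_ubr. Qed.

Lemma bpos_ub x : x ≼ bpos x. Proof. exact: bsup_ubl. Qed.

Lemma bpos_le x y : x ≼ y -> 0 ≼ y -> bpos x ≼ y.
Proof. exact: bsup_lub. Qed.

Lemma bpos_mono x y : x ≼ y -> bpos x ≼ bpos y.
Proof.
move=> xy; apply: bpos_le; last exact: bpos_ge0.
exact: ble_trans xy (bpos_ub y).
Qed.

Lemma bpos_subK x : bpos x - bpos (- x) = x.
Proof.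
apply/eqP; rewrite subr_eq; apply/eqP; apply: ble_anti.
- apply: bpos_le; first exact/bleDl/bpos_ge0.
  by rewrite -(subrr x); apply: bleD2l; apply: bpos_ub.
- rewrite addrC; apply: bleBr; apply: bpos_le.
    by rewrite -[X in X ≼ _]add0r; apply: bleD2r; exact: bpos_ge0.
  by apply: bge0_sub; exact: bpos_ub.
Qed.

Lemma bposZ r x : 0 < r -> bpos (r *: x) = r *: bpos x.
Proof.
move=> r0; have rN0 : r != 0 by rewrite gt_eqF.
apply: ble_anti.
- apply: bpos_le; first by apply: bleZ; [exact: ltW|exact: bpos_ub].
  by apply: bscale_ge0; [exact: ltW|exact: bpos_ge0].
- rewrite -[X in _ ≼ X]scale1r -(mulfV rN0) -scalerA.
  apply: bleZ; first exact: ltW.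
  have r'0 : 0 <= r^-1 by rewrite invr_ge0 ltW.
  apply: bpos_le; last by apply: bscale_ge0 => //; exact: bpos_ge0.
  rewrite -[X in X ≼ _]scale1r -(mulVf rN0) -scalerA.
  by apply: bleZ => //; exact: bpos_ub.
Qed.

Lemma bpos_le_abs x : bpos x ≼ bl_abs x.
Proof. by apply: bpos_le; [exact: babs_ub|exact: babs_ge0]. Qed.

(** The cone is norm closed because [bpos (- l)] is below [|l - y n|] as soon as [y n] is
    positive. *)
Lemma bge0_closed (y : nat -> E) (l : E) :
  y @ \oo --> l -> (\forall n \near \oo, 0 ≼ y n) -> 0 ≼ l.
Proof.
move=> yl y0; suff h : bpos (- l) = 0.
  by have := bpos_ub (- l); rewrite h => /bleN; rewrite opprK oppr0.
apply/eqP; rewrite -normr_le0; apply/ler_addgt0Pr => e e0.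
rewrite add0r.
move/cvgrPdist_le : yl => /(_ _ e0) yl.
near \oo => n.
have yn0 : 0 ≼ y n by near: n.
have yle : `|l - y n| <= e by near: n.
apply: le_trans yle; apply: bnorm_le.
rewrite (bge0_abs (bpos_ge0 _)).
apply: bpos_le; last exact: babs_ge0.
apply: ble_trans (babs_ubN _); rewrite opprB.
by rewrite -[X in X ≼ _]add0r; apply: bleD2r.
Unshelve. all: by end_near. Qed.

Lemma binf_lbl x y : bl_inf x y ≼ x.
Proof. by rewrite -[X in _ ≼ X]opprK; apply: bleN; apply: bsup_ubl. Qed.

Lemma binf_lbr x y : bl_inf x y ≼ y.
Proof. by rewrite -[X in _ ≼ X]opprK; apply: bleN; apply: bsup_ubr. Qed.

Lemma binf_glb x y z : z ≼ x -> z ≼ y -> z ≼ bl_inf x y.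
Proof.
move=> zx zy; rewrite -[X in X ≼ _]opprK; apply: bleN.
by apply: bsup_lub; apply: bleN.
Qed.

(** Truncate [y] to the interval from [- a] to [a]: as [|y| <= a + b], what is cut off on either
    side is at most [b]. *)
Lemma riesz_decomposition y a b : 0 ≼ a -> 0 ≼ b -> bl_abs y ≼ a + b ->
  exists y1, bl_abs y1 ≼ a /\ bl_abs (y - y1) ≼ b.
Proof.
move=> a0 b0 yab.
have y_ab : y ≼ a + b := ble_trans (babs_ub y) yab.
have yN_ab : - y ≼ a + b := ble_trans (babs_ubN y) yab.
have Na : - a ≼ a.
  by apply: (ble_trans (y := 0)) => //; rewrite -oppr0; apply: bleN.
exists (BL_sup (bl_inf y a) (- a)); split; apply: babs_le.
- by apply: bsup_lub; [exact: binf_lbr|].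
- by rewrite -[X in _ ≼ X]opprK; apply: bleN; apply: bsup_ubr.
- apply: ble_subl; rewrite addrC; apply: bleBl.
  apply: ble_trans (bsup_ubl _ _).
  apply: binf_glb; last exact: ble_subl.
  by rewrite -[X in _ ≼ X]addr0; apply: bleD2l; rewrite -oppr0; apply: bleN.
- rewrite opprB; apply: ble_subl; apply: bsup_lub.
    by apply: ble_trans (binf_lbl _ _) _; apply: bleDr.
  rewrite -[X in _ ≼ X]opprK opprD; apply: bleN.
  by rewrite addrC; apply: ble_subl.
Qed.

(* For [0 ≼ a] and [0 ≼ b] this says that the infimum of [a] and [b] is [0]. *)
Definition bdisj a b := forall z, z ≼ a -> z ≼ b -> z ≼ 0.

Lemma bdisjS a b x y : bdisj a b -> x ≼ a -> y ≼ b -> bdisj x y.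
Proof.
by move=> ab xa yb z zx zy; apply: ab; [exact: ble_trans xa|exact: ble_trans yb].
Qed.

(** If [z] is below [a + b] and [c], then [z - b] is below [a] and [c], so that [z] is below [b] and
    [c]. *)
Lemma bdisjD a b c : 0 ≼ b -> bdisj a c -> bdisj b c -> bdisj (a + b) c.
Proof.
move=> b0 ac bc z zab zc; apply: bc => //.
rewrite -[b]add0r; apply: bleBl; apply: ac; first exact: ble_subl.
by apply: ble_subl; apply: ble_trans zc (bleDl _ b0).
Qed.

Lemma bdisj_sum (I : Type) (s : seq I) (P : pred I) (f : I -> E) c : 0 ≼ c ->
  (forall i, P i -> 0 ≼ f i) -> (forall i, P i -> bdisj (f i) c) ->
  bdisj (\sum_(i <- s | P i) f i) c.
Proof.
move=> c0 f0 fc; suff [] : 0 ≼ \sum_(i <- s | P i) f i /\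
  bdisj (\sum_(i <- s | P i) f i) c by [].
elim/big_ind : _ => [|x y [x0 xc] [y0 yc]|i Pi].
- by split=> //; exact: ble_refl.
- by split; [exact: baddr_ge0|exact: bdisjD].
- by split; [exact: f0|exact: fc].
Qed.

(** The vector [a + b - u] lies below both [a] and [b]. *)
Lemma bdisjD_le a b u : bdisj a b -> a ≼ u -> b ≼ u -> a + b ≼ u.
Proof.
move=> ab au bu; rewrite -[u]add0r; apply: bleBl; apply: ab.
- by apply: ble_subl; apply: bleD2l.
- by rewrite [a + b]addrC; apply: ble_subl; apply: bleD2l.
Qed.

(** If [z] is below both parts, then [bpos (- x) - z] still dominates [- x] and [0], hence also
    [bpos (- x)]. *)
Lemma bdisj_pos_neg x : bdisj (bpos x) (bpos (- x)).
Proof.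
move=> z zp zn.
suff h : bpos (- x) ≼ bpos (- x) - z.
  rewrite -(subrr (bpos (- x))); apply: ble_subr; rewrite addrC.
  exact: bleBr.
apply: bpos_le; last exact: bge0_sub.
apply: ble_subr; rewrite addrC; apply: ble_subl; apply: ble_trans zp _.
by rewrite -{3}(bpos_subK x) addrC subrK; apply: ble_refl.
Qed.

Lemma bdisjZ r a b : 1 <= r -> 0 ≼ a -> 0 ≼ b -> bdisj a b ->
  bdisj (r *: a) (r *: b).
Proof.
move=> r1 a0 b0 ab z za zb.
have r0 : 0 < r by exact: lt_le_trans r1.
have rV0 : 0 <= r^-1 by rewrite invr_ge0 ltW.
have := ab (r^-1 *: z).
move=> /(_ _ _)/(bleZ (ltW r0)).
rewrite scaler0 scalerA mulfV ?gt_eqF// scale1r; apply.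
- by have := bleZ rV0 za; rewrite scalerA mulVf ?gt_eqF// scale1r.
- by have := bleZ rV0 zb; rewrite scalerA mulVf ?gt_eqF// scale1r.
Qed.

End BanachLatticeTheory.

(** * Hahn-Banach theorem and uniform boundedness *)

Section HahnBanach.
Context {R : realType} {X : lmodType R}.
Implicit Types (p : X -> R) (x y : X).

(** Homogeneity as a one-sided inequality is easier to check; [sublinearZ] recovers equality by
    scaling back with the inverse. *)
Definition sublinear p : Prop :=
  (forall x y, p (x + y) <= p x + p y) /\
  (forall (a : R) x, 0 < a -> p (a *: x) <= a * p x).

Lemma sublinear0 p : sublinear p -> p 0 = 0.
Proof.
move=> [pD pZ]; have := pD 0 0; rewrite addr0 => h.
have h2 : 0 < 2^-1 :> R by rewrite invr_gt0.
by have := pZ 2^-1 0 h2; rewrite scaler0; lra.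
Qed.

Lemma sublinearN p x : sublinear p -> - p (- x) <= p x.
Proof.
move=> sp; have [pD _] := sp.
by have := pD x (- x); rewrite subrr (sublinear0 sp); lra.
Qed.

Lemma sublinearZ p (a : R) x : sublinear p -> 0 <= a -> p (a *: x) = a * p x.
Proof.
move=> sp; rewrite le_eqVlt => /predU1P[<-|a0].
  by rewrite scale0r mul0r sublinear0.
have [_ pZ] := sp; apply: le_anti; rewrite pZ//=.
have := pZ a^-1 (a *: x); rewrite invr_gt0 => /(_ a0).
by rewrite scalerA mulVf ?gt_eqF// scale1r ler_pdivlMl.
Qed.

(* A sublinear functional below [p] whose value at [- y] is at most [- p y]. *)
Definition push p y x : R :=
  inf [set p (x + t *: y) - t * p y | t in [set t | 0 <= t]].

(** A bound free of [t]: the infimum in [push] is over a set bounded below. *)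
Lemma push_lb p y x (t : R) : sublinear p -> 0 <= t ->
  - p (- x) <= p (x + t *: y) - t * p y.
Proof.
move=> sp t0; rewrite -(sublinearZ y sp t0); have [pD _] := sp.
have := pD (x + t *: y) (- x); rewrite addrAC subrr add0r; lra.
Qed.

Lemma push_le p y x (t : R) : sublinear p -> 0 <= t ->
  push p y x <= p (x + t *: y) - t * p y.
Proof.
move=> sp t0; apply: ge_inf; last by exists t.
by exists (- p (- x)) => _ [s /= s0 <-]; exact: push_lb.
Qed.

Lemma le_push p y x c : (forall t : R, 0 <= t -> c <= p (x + t *: y) - t * p y) ->
  c <= push p y x.
Proof.
move=> h; apply: lb_le_inf => [|_ [t /= t0 <-]]; last exact: h.
by exists (p (x + 0 *: y) - 0 * p y); exists 0 => /=.
Qed.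

Lemma push_sublinear p y : sublinear p -> sublinear (push p y).
Proof.
move=> sp; have [pD _] := sp; split => [x x'|a x a0].
  rewrite -lerBlDr; apply: le_push => t t0.
  rewrite lerBlDr [X in _ <= X]addrC -lerBlDr; apply: le_push => s s0.
  rewrite lerBlDr.
  (* The parameters [t] for [x] and [s] for [x'] combine to [t + s] for [x + x']. *)
  have := push_le y (x + x') sp (addr_ge0 t0 s0).
  rewrite scalerDl addrACA; have := pD (x + t *: y) (x' + s *: y); lra.
rewrite -ler_pdivrMl//; apply: le_push => t t0.
rewrite ler_pdivrMl//.
have := push_le y (a *: x) sp (mulr_ge0 (ltW a0) t0).
by rewrite -scalerA -scalerDr (sublinearZ _ sp (ltW a0)); lra.
Qed.

Lemma minimal_sublinear p : sublinear p ->
  exists f, [/\ sublinear f, forall x, f x <= p x &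
    forall g, sublinear g -> (forall x, g x <= f x) -> forall x, f x <= g x].
Proof.
move=> sp.
pose T := {f : X -> R | sublinear f /\ forall x, f x <= p x}.
have pT : sublinear p /\ forall x, p x <= p x by split.
(* The order is reversed, so that Zorn's lemma yields a minimal element. *)
pose le_T (f g : T) := `[< forall x, sval g x <= sval f x >].
have [|f g h|A totA|f fmin] := @ZL_preorder T (exist _ p pT) le_T.
- by move=> f; apply/asboolP.
- move=> /asboolP fg /asboolP gh; apply/asboolP => x.
  exact: le_trans (gh x) (fg x).
- have [[f0 Af0]|A0] := pselect (A !=set0); last first.
    by exists (exist _ p pT) => s As; case: A0; exists s.
  (* A nonempty chain is bounded by its pointwise infimum. *)
  pose g x : R := inf [set sval s x | s in A].
  have As s x : A s -> - p (- x) <= sval s x.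
    move=> _; have [ss sleq] := svalP s.
    by have := sublinearN x ss; have := sleq (- x); lra.
  have g_le s x : A s -> g x <= sval s x.
    move=> Ass; apply: ge_inf; last by exists s.
    by exists (- p (- x)) => _ [t /= At <-]; exact: As.
  have le_inf_g x c : (forall s, A s -> c <= sval s x) -> c <= g x.
    move=> h; apply: lb_le_inf => [|_ [t /= At <-]]; last exact: h.
    by exists (sval f0 x); exists f0.
  have gT : sublinear g /\ forall x, g x <= p x.
    split; last by move=> x; apply: le_trans (g_le f0 x Af0) ((svalP f0).2 x).
    split => [x y|a x a0].
      rewrite -lerBlDr; apply: (le_inf_g) => s Ass.
      rewrite lerBlDr [X in _ <= X]addrC -lerBlDr; apply: (le_inf_g) => t At.
      rewrite lerBlDr.
      (* Subadditivity needs a single member of the chain at both points: the smaller of [s] and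
         [t]. *)
      have [/asboolP ts|/asboolP ts] := totA _ _ Ass At.
        have [[tD _] _] := svalP t; have := g_le t (x + y) At.
        by have := tD x y; have := ts x; lra.
      have [[sD _] _] := svalP s; have := g_le s (x + y) Ass.
      by have := sD x y; have := ts y; lra.
    rewrite -ler_pdivrMl//; apply: (le_inf_g) => t At; rewrite ler_pdivrMl//.
    have [[_ tZ] _] := svalP t.
    exact: le_trans (g_le t _ At) (tZ a x a0).
  by exists (exist _ g gT) => s Ass; apply/asboolP => x; exact: g_le.
- have [sf fp] := svalP f.
  exists (sval f); split => // g sg gf.
  have gT : sublinear g /\ forall x, g x <= p x.
    by split=> // x; apply: le_trans (gf x) (fp x).
  have /asboolP := fmin (exist _ g gT) (introT (asboolP _) gf).
  by [].
Qed.

(* A minimal sublinear [f] satisfies [push f y = f], which at [- y] says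
   [f (- y) = - f y]; hence [f] is additive. *)
Lemma hahn_banach p y : sublinear p ->
  exists f : X -> R, [/\ forall (a : R) u v, f (a *: u + v) = a * f u + f v,
    forall x, f x <= p x & f y = p y].
Proof.
move=> sp.
(* Starting from [push p y] instead of [p] gives [f (- y) <= - p y], hence [f y = p y] once [f] is
   odd. *)
have [f [sf fq fmin]] := minimal_sublinear (push_sublinear y sp).
have fp x : f x <= p x.
  by have := push_le y x sp (lexx 0); have := fq x; rewrite scale0r addr0; lra.
have fN z : f (- z) = - f z.
  have h1 := fmin _ (push_sublinear z sf).
  have h2 x : push f z x <= f x.
    by have := push_le z x sf (lexx 0); rewrite scale0r addr0 mul0r subr0.
  have := push_le z (- z) sf ler01.
  rewrite scale1r mul1r addNr (sublinear0 sf) sub0r.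
  have := h1 h2 (- z); have := sublinearN z sf; have := sublinearN (- z) sf.
  by rewrite opprK; lra.
have [fD _] := sf.
have fDE u v : f (u + v) = f u + f v.
  apply: le_anti; rewrite fD/=.
  by have := fD (u + v) (- v); rewrite addrK fN; lra.
exists f; split => // [a u v|].
  rewrite fDE; congr (_ + _); have [a0|a0] := leP 0 a.
    exact: sublinearZ.
  rewrite -[a]opprK scaleNr fN sublinearZ// ?mulNr//.
  by rewrite oppr_ge0 ltW.
apply: le_anti; rewrite fp/=.
have := push_le y (- y) sp ler01; rewrite scale1r mul1r addNr (sublinear0 sp).
by have := fq (- y); rewrite fN; lra.
Qed.
End HahnBanach.

(** * Bounded operators, norming functionals, uniform boundedness *)

Section Operators.
Context {R : realType}.

Lemma linear_bounded_is_operator (X Y : normedModType R) (f : X -> Y) (K : R) :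
  (forall (a : R) x y, f (a *: x + y) = a *: f x + f y) ->
  (forall x, `|f x| <= K * `|x|) -> is_operator f.
Proof.
move=> fL fK; split => // x.
pose g : {linear X -> Y} := HB.pack f (GRing.isLinear.Build _ _ _ _ f fL).
apply: (@bounded_linear_continuous R X Y g).
apply/linear_boundedP; near=> r => y; apply: le_trans (fK y) _.
by apply: ler_wpM2r => //; near: r; apply: nbhs_pinfty_ge; rewrite num_real.
Unshelve. all: by end_near. Qed.

Lemma operator_bounded (X Y : normedModType R) (f : X -> Y) : is_operator f ->
  exists2 K : R, 0 <= K & forall x, `|f x| <= K * `|x|.
Proof.
move=> [fL fc].
pose g : {linear X -> Y} := HB.pack f (GRing.isLinear.Build _ _ _ _ f fL).
have /linear_boundedP h : bounded_near g (nbhs (0 : X)).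
  exact/linear_bounded_continuous.
near +oo_R => r; exists r; first by near: r; apply: nbhs_pinfty_ge; rewrite num_real.
by move=> x; move: x; near: r.
Unshelve. all: by end_near. Qed.

Lemma linear_bounded_is_functional (X : normedModType R) (f : X -> R) (K : R) :
  (forall (a : R) x y, f (a *: x + y) = a * f x + f y) ->
  (forall x, `|f x| <= K * `|x|) -> is_functional f.
Proof. exact: (@linear_bounded_is_operator X R^o). Qed.

Lemma functional_bounded (X : normedModType R) (f : X -> R) : is_functional f ->
  exists2 K : R, 0 <= K & dual_bounded f K.
Proof. exact: (@operator_bounded X R^o). Qed.

Lemma operatorP (X Y : normedModType R) (T : X -> Y) : is_operator T ->
  [/\ T 0 = 0, forall x y, T (x + y) = T x + T y, forall x, T (- x) = - T x &
     forall (a : R) x, T (a *: x) = a *: T x].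
Proof.
move=> [TL _].
have T0 : T 0 = 0.
  by have := TL (-1) 0 0; rewrite scaler0 addr0 scaleN1r addNr.
have TZ a x : T (a *: x) = a *: T x by rewrite -[a *: x]addr0 TL T0 addr0.
split=> // [x y|x]; first by have := TL 1 x y; rewrite !scale1r.
by rewrite -scaleN1r TZ scaleN1r.
Qed.

Lemma functionalP (X : normedModType R) (f : X -> R) : is_functional f ->
  [/\ f 0 = 0, forall x y, f (x + y) = f x + f y, forall x, f (- x) = - f x &
     forall (a : R) x, f (a *: x) = a * f x].
Proof. exact: (@operatorP X R^o). Qed.

Lemma functional_comp (X Y : normedModType R) (T : X -> Y) (f : Y -> R) :
  is_operator T -> is_functional f -> is_functional (f \o T).
Proof.
move=> [TL Tc] [fL fc]; split=> [a x y|x] /=; first by rewrite TL fL.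
by apply: continuous_comp; [exact: Tc|exact: fc].
Qed.

Lemma norming_functional (X : normedModType R) (x : X) :
  exists f : X -> R, [/\ is_functional f, dual_bounded f 1 & f x = `|x|].
Proof.
have sn : sublinear (fun x : X => `|x|).
  split=> [u v|a u a0]; first exact: ler_normD.
  by rewrite normrZ gtr0_norm.
have [f [fL fn fx]] := hahn_banach x sn.
have fb : dual_bounded f 1.
  move=> u; rewrite mul1r ler_norml fn andbT lerNl.
  have f0 : f 0 = 0 by have := fL (-1) 0 0; rewrite scaler0 addr0; lra.
  by have := fn (- u); rewrite normrN -scaleN1r -[_ *: u]addr0 fL f0; lra.
by exists f; split=> //; apply: linear_bounded_is_functional fb.
Qed.

(* Sokal's proof of the uniform boundedness principle, applied to the dual: the
   signs in [f = \sum_k +- 3^-k h_k], with [h_k] norming [z k] and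
   [`|z k| > 9^k], are chosen so that the k-th term is not cancelled at [z k]
   by the previous ones. *)
Lemma weakly_bounded (X : normedModType R) (x : nat -> X) :
  (forall f, is_functional f -> exists M : R, forall n, `|f (x n)| <= M) ->
  exists M : R, forall n, `|x n| <= M.
Proof.
move=> xb; apply: contrapT => xunb.
have /choice [nk nkP] : forall k, exists n, 9 ^+ k < `|x n|.
  move=> k; apply: contrapT => h; apply: xunb; exists (9 ^+ k) => n.
  by rewrite leNgt; apply/negP => h'; apply: h; exists n.
pose z k := x (nk k).
have /choice [h hP] := fun k => norming_functional (z k).
pose F := fix F k : X -> R := if k is k'.+1 then fun u =>
  F k' u + (if 0 <= F k' (z k') then 1 else -1) * 3 ^- k' * h k' u else fun=> 0.
have FS k u : F k.+1 u =
    F k u + (if 0 <= F k (z k) then 1 else -1) * 3 ^- k * h k u by [].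
have p3 k : 0 < 3 ^- k :> R by rewrite invr_gt0 exprn_gt0.
have p3S k : 3 ^- k.+1 = 3 ^- k / 3 :> R by rewrite exprS invfM mulrC.
have step k u : `|F k.+1 u - F k u| <= 3 ^- k * `|u|.
  rewrite FS addrC addKr !normrM (gtr0_norm (p3 k)).
  have -> : `|(if 0 <= F k (z k) then 1 else -1) : R| = 1.
    by case: ifP; rewrite ?normrN normr1.
  rewrite mul1r ler_pM2l//; have [_ hb _] := hP k.
  by have := hb u; rewrite mul1r.
(* [F k (z k)] and the new term never have opposite signs, so their absolute values add up. *)
have Fbig k : 3 ^- k * `|z k| <= `|F k.+1 (z k)|.
  rewrite FS; have [_ _ ->] := hP k.
  have : 0 <= 3 ^- k * `|z k| by rewrite mulr_ge0// ltW.
  rewrite -!mulrA; move: (F k (z k)) (_ * `|z k|) => c b b0.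
  case: ifP => [c0|/negbT]; first by rewrite mul1r ger0_norm; lra.
  by rewrite -ltNge => c0; rewrite mulN1r ler0_norm; lra.
(* The factor is the geometric sum of [3 ^- i] over [k <= i < j + k]. *)
have Fdist k j u : `|F (j + k)%N u - F k u| <= 3/2 * (3 ^- k - 3 ^- (j + k)) * `|u|.
  elim: j => [|j IH]; first by rewrite add0n !subrr normr0 mulr0 mul0r.
  rewrite addSn (le_trans (ler_distD (F (j + k)%N u) _ _))//.
  move: IH (step (j + k)%N u); rewrite p3S.
  move: `|F _ _ - _| `|F _ _ - _| (3 ^- k) (3 ^- (j + k)) `|u| => c d a b v.
  lra.
have Fcvg u : cvgn (F^~ u).
  (* Subtracting the bound on all remaining increments makes the sequence monotone. *)
  pose G k := F k u - 3/2 * 3 ^- k * `|u|.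
  have Gcvg : cvgn G.
    apply: nondecreasing_is_cvgn.
      apply/nondecreasing_seqP => k; rewrite /G p3S.
      have := step k u; rewrite ler_norml => /andP[+ _].
      by move: (F _ _) (F _ _) (3 ^- k) `|u| => c d a b; lra.
    exists (3/2 * `|u|) => _ [k _ <-]; rewrite /G.
    have := Fdist 0%N k u; rewrite addn0 expr0 invr1 subr0 ler_norml => /andP[_].
    have : 0 <= 3 ^- k * `|u| by rewrite mulr_ge0// ltW.
    by move: (F _ _) (3 ^- k) `|u| => c a b; lra.
  have -> : F^~ u = G + (fun k => 3/2 * 3 ^- k * `|u|).
    by apply/funext => k; rewrite [RHS]subrK.
  apply: is_cvgD => //; apply: is_cvgM; last exact: is_cvg_cst.
  apply: is_cvgM; first exact: is_cvg_cst.
  apply/cvg_ex; exists 0; under eq_fun do rewrite -exprVn.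
  by apply: cvg_expr; rewrite ger0_norm ?invr_ge0// invf_lt1// ltr1n.
pose f u := limn (F^~ u).
have fF k u : `|f u - F k u| <= 3/2 * 3 ^- k * `|u|.
  have Fk : (fun j => `|F j u - F k u|) @ \oo --> `|f u - F k u|.
    by apply: cvg_norm; apply: cvgB; [exact: Fcvg|exact: cvg_cst].
  apply: (cvgr_to_le Fk); exists k => // j /= kj.
  rewrite -(subnK kj); apply: le_trans (Fdist _ _ _) _.
  apply: ler_wpM2r => //; apply: ler_wpM2l; first lra.
  by rewrite gerBl ltW.
have FL k (a : R) u v : F k (a *: u + v) = a * F k u + F k v.
  elim: k => [|k IH]; first by rewrite /= mulr0 addr0.
  rewrite !FS IH; have [[hL _] _ _] := hP k; rewrite hL.
  by move: (if _ then _ else _) => s; ring.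
have ff : is_functional f.
  apply: (@linear_bounded_is_functional _ _ (3/2)) => [a u v|u].
    have -> : f (a *: u + v) = limn (fun k => a * F k u + F k v).
      by congr (lim _); under eq_fun do rewrite FL.
    apply: cvg_lim => //; apply: cvgD; last exact: Fcvg.
    by apply: cvgMl_tmp; exact: Fcvg.
  by have := fF 0%N u; rewrite subr0 expr0 invr1 mulr1.
have [M fM] := xb f ff.
(* At [z k] the later terms cancel at most half of the k-th one, so [|f (z k)| >= 3 ^- k * |z k| / 2
   > 3 ^+ k / 2]; this must exceed [M]. *)
have [k h5] : exists k, 2 * M < 3 ^+ k.
  have M0 : 0 <= M := le_trans (normr_ge0 _) (fM 0%N).
  exists (Num.bound (2 * M)).
  apply: lt_le_trans (archi_boundP (mulr_ge0 _ M0)) _ => //.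
  by rewrite -natrX ler_nat ltnW// ltn_expl.
have h1 : `|f (z k)| <= M := fM (nk k).
have h2 := fF k.+1 (z k); have h3 := Fbig k.
have h4 : 3 ^+ k < 3 ^- k * `|z k|.
  rewrite ltr_pdivlMl ?exprn_gt0// -exprMn.
  by rewrite (_ : 3 * 3 = 9); [exact: nkP|ring].
have := ler_distD (f (z k)) (F k.+1 (z k)) 0.
rewrite !subr0 distrC; move: h1 h2 h3 h4 h5; rewrite p3S.
move: (F k.+1 (z k)) (f (z k)) => c d; move: (3 ^- k : R) (3 ^+ k : R) `|z k| => a b e.
by lra.
Qed.

Lemma weak_null_bounded (X : normedModType R) (x : nat -> X) :
  weak_cvg x 0 -> exists M : R, forall n, `|x n| <= M.
Proof.
move=> x0; apply: weakly_bounded => f ff.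
have /cvg_seq_bounded fb : cvgn (fun n => f (x n)).
  by apply/cvg_ex; exists (f 0); exact: x0.
near +oo_R => M; exists M => n.
have : forall y, [set: nat] y -> `|f (x y)| <= M by near: M.
exact.
Unshelve. all: by end_near. Qed.

End Operators.

(** * Disjoint sequences *)

Section DisjointSequences.
Context {R : realType} {E : BanachLattice R}.

Lemma bscale_le (r s : R) (a : E) : 0 ≼ a -> r <= s -> r *: a ≼ s *: a.
Proof.
move=> a0 rs; apply: bsub_ge0; rewrite -scalerBl.
by apply: bscale_ge0; rewrite ?subr_ge0.
Qed.

Lemma bpos_subr_le (x a b : E) : b ≼ a -> bpos (x - a) ≼ bpos (x - b).
Proof. by move=> ba; apply: bpos_mono; apply: bleD2l; apply: bleN. Qed.

(** The infima [w n] of [v n] and [u] are disjoint and below [u], so their sums stay below [u].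
    Hence the series of [|f (w n)|] converges and its terms tend to [0]. *)
Lemma disjoint_uaw_null (v : nat -> E) : (forall n, 0 ≼ v n) ->
  (forall m n, (m < n)%N -> bdisj (v m) (v n)) -> uaw_cvg v 0.
Proof.
move=> v0 vd u u0 f ff.
pose w n := bl_inf (bl_abs (v n - 0)) u.
rewrite -[X in X @ _ --> _]/(fun n => f (w n)).
have wv n : w n ≼ v n.
  by apply: ble_trans (binf_lbl _ _) _; rewrite subr0 bge0_abs//; exact: ble_refl.
have wu n : w n ≼ u by exact: binf_lbr.
have w0 n : 0 ≼ w n by apply: binf_glb => //; exact: babs_ge0.
have sum_le N : \sum_(0 <= i < N) w i ≼ u.
  elim: N => [|N IH]; first by rewrite big_geq.
  rewrite big_nat_recr//=; apply: bdisjD_le => //.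
  rewrite big_mkord; apply: bdisj_sum => // i _.
  by apply: bdisjS (vd _ _ (ltn_ord i)) _ _.
have [K K0 fK] := functional_bounded ff.
have [f0 fD fN _] := functionalP ff.
(* [y] is the sum of the [w i] taken with the signs of [f (w i)]. *)
have signs N : exists y, bl_abs y ≼ \sum_(0 <= i < N) w i /\
    f y = \sum_(0 <= i < N) `|f (w i)|.
  elim: N => [|N [y [yw fy]]].
    exists 0; rewrite !big_geq// bge0_abs; last exact: ble_refl.
    by split=> //; exact: ble_refl.
  rewrite !big_nat_recr//= -fy.
  have [fw|fw] := leP 0 (f (w N)).
    exists (y + w N); split; last by rewrite fD ger0_norm.
    apply: ble_trans (babs_triangle _ _) _; apply: bleD => //.
    by rewrite bge0_abs//; exact: ble_refl.
  exists (y - w N); split; last by rewrite fD fN ltr0_norm.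
  apply: ble_trans (babs_triangle _ _) _; apply: bleD => //.
  by rewrite babsN bge0_abs//; exact: ble_refl.
rewrite f0; apply: norm_cvg0; apply: cvg_series_cvg_0.
apply: nondecreasing_is_cvgn.
  by apply: nondecreasing_series => i _ _; exact: normr_ge0.
exists (K * `|u|) => _ [N _ <-].
have [y [yw fy]] := signs N.
rewrite /series/= -fy; apply: le_trans (ler_norm _) _; apply: le_trans (fK y) _.
by apply: ler_wpM2l => //; apply: bnorm_absle; exact: ble_trans yw (sum_le N).
Qed.

(* Aliprantis--Burkinshaw, Positive Operators, Theorem 4.36. If no [u] works,
   there are [x n] with [`|T (x n - 4^n S n)^+| > eps], where [S n] is the sum of
   the previous terms. With [y = \sum_n 2^-n x n], the vectors
   [v n = (x n - 4^n S n - 2^-n y)^+] are disjoint and differ from these positive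
   parts by at most [2^-n y]. *)
Lemma disjoint_approx (X : normedModType R) (T : E -> X) (M eps : R) :
  is_operator T ->
  (forall v : nat -> E, (forall n, 0 ≼ v n) -> (forall n, `|v n| <= M) ->
    (forall m n, (m < n)%N -> bdisj (v m) (v n)) ->
    (fun n => `|T (v n)|) @ \oo --> (0 : R)) ->
  0 < eps ->
  exists2 u, 0 ≼ u & forall x, 0 ≼ x -> `|x| <= M -> `|T (bpos (x - u))| <= eps.
Proof.
move=> opT Tdisj eps0; apply: contrapT => noU.
have /choice [c cP] : forall u, exists x, 0 ≼ u ->
    [/\ 0 ≼ x, `|x| <= M & eps < `|T (bpos (x - u))| ].
  move=> u; apply: contrapT => h; apply: noU; exists u.
    by apply: contrapT => u0; apply: h; exists 0.
  move=> x x0 xM; rewrite leNgt; apply/negP => xe; apply: h.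
  by exists x.
pose S := fix S n : E := if n is n'.+1 then S n' + c (4 ^+ n' *: S n') else 0.
pose x n := c (4 ^+ n *: S n).
have SS n : S n.+1 = S n + x n by [].
have four_ge0 n : 0 <= 4 ^+ n :> R by rewrite exprn_ge0.
have S0 n : 0 ≼ S n.
  elim: n => [|n IH]; first exact: ble_refl.
  rewrite SS; apply: baddr_ge0 => //.
  by have [] := cP _ (bscale_ge0 (four_ge0 n) IH).
have xP n := cP _ (bscale_ge0 (four_ge0 n) (S0 n)).
have x0 n : 0 ≼ x n by have [] := xP n.
have xM n : `|x n| <= M by have [] := xP n.
have xT n : eps < `|T (bpos (x n - 4 ^+ n *: S n))| by have [] := xP n.
have xS m n : (m < n)%N -> x m ≼ S n.
  elim: n => [//|n IH]; rewrite ltnS leq_eqVlt SS => /predU1P[->|/IH mn].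
    exact: bleDr.
  exact: ble_trans mn (bleDl _ (x0 n)).
have half0 n : 0 < 2^-1 ^+ n :> R by rewrite exprn_gt0// invr_gt0.
(* The weights make the series of the bounded [x n] converge absolutely. *)
pose t n := 2^-1 ^+ n *: x n.
have tcvg : cvgn (series t).
  apply: normed_cvg; apply: (series_le_cvg (v_ := geometric M 2^-1)).
  - by move=> n; exact: normr_ge0.
  - by move=> n; apply: mulr_ge0; [exact: le_trans (normr_ge0 _) (xM n)|exact: ltW].
  - by move=> n /=; rewrite normrZ gtr0_norm// mulrC ler_wpM2r// ltW.
  - by apply: is_cvg_geometric_series; rewrite ger0_norm ?invr_ge0// invf_lt1// ltr1n.
pose y := limn (series t).
(* For [N > n] the partial sum minus [t n] is a sum of positive terms, and the cone is closed. *)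
have ty n : t n ≼ y.
  apply: bsub_ge0; apply: (@bge0_closed _ _ (fun N => series t N - t n)).
    by apply: cvgB; [exact: tcvg|exact: cvg_cst].
  exists n.+1 => // N /= nN.
  rewrite /series/= (bigD1_seq n)//= ?mem_index_iota ?iota_uniq//.
  rewrite addrAC subrr add0r; apply: bsum_ge0 => i _.
  by apply: bscale_ge0; [exact: ltW|exact: x0].
have y0 : 0 ≼ y by apply: ble_trans (ty 0%N); rewrite /t expr0 scale1r.
pose v n := bpos (x n - 4 ^+ n *: S n - 2^-1 ^+ n *: y).
have vw n : v n ≼ bpos (x n - 4 ^+ n *: S n).
  apply: bpos_mono; rewrite -[X in _ ≼ X]subr0; apply: bleD2l; apply: bleN.
  by apply: bscale_ge0 => //; exact: ltW.
have wv n : bpos (x n - 4 ^+ n *: S n) ≼ v n + 2^-1 ^+ n *: y.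
  have hy : 0 ≼ 2^-1 ^+ n *: y by apply: bscale_ge0 => //; exact: ltW.
  apply: bpos_le; last by apply: baddr_ge0 => //; exact: bpos_ge0.
  by apply: bleBl; exact: bpos_ub.
have vM n : `|v n| <= M.
  apply: le_trans (xM n); apply: bnorm_mono; first exact: bpos_ge0.
  apply: ble_trans (vw n) _; apply: bpos_le => //.
  rewrite -[X in _ ≼ X]subr0; apply: bleD2l; apply: bleN.
  exact: bscale_ge0.
have vdisj m n : (m < n)%N -> bdisj (v m) (v n).
  (* Let [q = x m - x n / d]. From [2^-m y >= x n / d] one gets [v m] below [bpos q]; from
     [4^n S n >= 4^n x m >= d x m], where [m < n] matters twice, [v n] is below [d] times
     [bpos (- q)]. *)
  move=> mn; pose d : R := 2 ^+ (m + n).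
  have d0 : 0 < d by rewrite exprn_gt0.
  have d1 : 1 <= d by rewrite exprn_ege1// ler1n.
  pose q := x m - d^-1 *: x n.
  have vm : v m ≼ d *: bpos q.
    apply: (ble_trans (y := bpos q)); last first.
      by rewrite -[X in X ≼ _]scale1r; apply: bscale_le => //; exact: bpos_ge0.
    rewrite /v -addrA -opprD; apply: bpos_subr_le.
    apply: (ble_trans (y := 2^-1 ^+ m *: y)); last first.
      by apply: bleDr; apply: bscale_ge0.
    have := bleZ (ltW (half0 m)) (ty n).
    by rewrite /t /d scalerA -exprD (exprVn _ (m + n)).
  have vn : v n ≼ d *: bpos (- q).
    rewrite -bposZ//; apply: ble_trans (vw n) _.
    rewrite /q opprB scalerBr scalerA mulfV ?gt_eqF// scale1r.
    apply: bpos_subr_le.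
    apply: (ble_trans (y := 4 ^+ n *: x m)); last by apply: bleZ => //; exact: xS.
    apply: bscale_le => //.
    rewrite /d (_ : 4 = 2 ^+ 2) ?expr2; last by ring.
    by rewrite -expr2 -exprM ler_weXn2l ?ler1n// mul2n -addnn leq_add2r ltnW.
  apply: bdisjS vm vn; apply: bdisjZ => //; [exact: bpos_ge0|exact: bpos_ge0|].
  exact: bdisj_pos_neg.
have Tv := Tdisj v (fun n => bpos_ge0 _) vM vdisj.
have [K K0 TK] := operator_bounded opT.
have [_ TD TN _] := operatorP opT.
have Tw n : `|T (bpos (x n - 4 ^+ n *: S n))| <= `|T (v n)| + 2^-1 ^+ n * (K * `|y|).
  rewrite -[X in T X](subrK (v n)) TD addrC; apply: le_trans (ler_normD _ _) _.
  rewrite lerD2l; apply: le_trans (TK _) _; rewrite mulrCA ler_wpM2l//.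
  have -> : 2^-1 ^+ n * `|y| = `|2^-1 ^+ n *: y|.
    by rewrite normrZ gtr0_norm.
  apply: bnorm_mono; first exact: bge0_sub.
  by apply: ble_subl; rewrite [X in _ ≼ X]addrC; exact: wv.
have lim0 : (fun n => `|T (v n)| + 2^-1 ^+ n * (K * `|y|)) @ \oo --> (0 : R).
  rewrite -[0 : R]addr0; apply: cvgD => //.
  rewrite -(mul0r (K * `|y|)); apply: cvgMr_tmp.
  by apply: cvg_expr; rewrite ger0_norm ?invr_ge0// invf_lt1// ltr1n.
(* The left-hand sides of [Tw] all exceed [eps], while the right-hand sides tend to [0]. *)
suff : eps <= 0 by rewrite leNgt eps0.
apply: (cvgr_to_ge lim0); exists 0%N => // n _.
by apply: le_trans (Tw n); exact: ltW.
Qed.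

End DisjointSequences.

(** * Modulus of a functional *)

Section Modulus.
Context {R : realType} {E : BanachLattice R}.
Variable f : E -> R.
Hypothesis ff : is_functional f.
Implicit Types x y a b : E.

(* The Riesz-Kantorovich formula; only meaningful for [0 ≼ a]. *)
Definition modulus_on a : R := sup [set f y | y in [set y | bl_abs y ≼ a]].

Lemma modulus_on_ub a y : bl_abs y ≼ a -> f y <= modulus_on a.
Proof.
move=> ya; apply: ub_le_sup; last by exists y.
have [K K0 fK] := functional_bounded ff.
exists (K * `|a|) => _ [z /= za <-].
apply: le_trans (ler_norm _) _; apply: le_trans (fK z) _.
by apply: ler_wpM2l => //; exact: bnorm_absle.
Qed.

Lemma modulus_on_le a c : 0 ≼ a -> (forall y, bl_abs y ≼ a -> f y <= c) ->
  modulus_on a <= c.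
Proof.
move=> a0 h; apply: ge_sup => [|_ [y /= ya <-]]; last exact: h.
by exists (f 0); exists 0 => //=; rewrite bge0_abs//; exact: ble_refl.
Qed.

(** Riesz decomposition gives [<=]; adding elements of the two intervals gives [>=]. *)
Lemma modulus_onD a b : 0 ≼ a -> 0 ≼ b ->
  modulus_on (a + b) = modulus_on a + modulus_on b.
Proof.
move=> a0 b0; have [f0 fD fN fZ] := functionalP ff.
apply: le_anti; apply/andP; split.
  apply: modulus_on_le => [|y yab]; first exact: baddr_ge0.
  have [y1 [y1a y2b]] := riesz_decomposition a0 b0 yab.
  by rewrite -[y](subrK y1) fD addrC lerD// modulus_on_ub.
rewrite -lerBrDr; apply: modulus_on_le => // y ya.
rewrite lerBrDr addrC -lerBrDr; apply: modulus_on_le => // z zb.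
rewrite lerBrDr addrC -fD; apply: modulus_on_ub.
by apply: ble_trans (babs_triangle _ _) _; apply: bleD.
Qed.

Lemma modulus_onZ (r : R) a : 0 <= r -> 0 ≼ a ->
  modulus_on (r *: a) = r * modulus_on a.
Proof.
move=> r0 a0; have [f0 fD fN fZ] := functionalP ff.
have absZ (s : R) y : 0 <= s -> bl_abs (s *: y) ≼ s *: bl_abs y.
  move=> s0; apply: babs_le; first exact/bleZ/babs_ub.
  by rewrite -scalerN; exact/bleZ/babs_ubN.
(* Used for [r] and for its inverse, this gives both inequalities. *)
have half (s : R) b : 0 < s -> 0 ≼ b -> s * modulus_on b <= modulus_on (s *: b).
  move=> s0 b0; rewrite -ler_pdivlMl//; apply: modulus_on_le => // y yb.
  rewrite ler_pdivlMl// -fZ; apply: modulus_on_ub.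
  by apply: ble_trans (absZ _ _ (ltW s0)) _; apply: bleZ => //; exact: ltW.
move: r0; rewrite le_eqVlt => /predU1P[<-|r0].
  have := modulus_onD (ble_refl 0) (ble_refl 0).
  by rewrite scale0r mul0r addr0; lra.
apply: le_anti; rewrite half// andbT -ler_pdivrMl//.
have rV0 : 0 < r^-1 by rewrite invr_gt0.
have := half _ (r *: a) rV0 (bscale_ge0 (ltW r0) a0).
by rewrite scalerA mulVf ?gt_eqF// scale1r.
Qed.

(** The modulus of [f] in the dual lattice, extended from the cone to all of [E]. *)
Definition modulus x : R := modulus_on (bpos x) - modulus_on (bpos (- x)).

(** Every decomposition into positive vectors gives the same value:
    [bpos (a - b) + b = a + bpos (- (a - b))], and [modulus_on] is additive on the cone. *)
Lemma modulusB a b : 0 ≼ a -> 0 ≼ b ->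
  modulus (a - b) = modulus_on a - modulus_on b.
Proof.
move=> a0 b0; rewrite /modulus.
have : bpos (a - b) + b = a + bpos (- (a - b)).
  apply/eqP; rewrite -subr_eq addrAC bpos_subK.
  by rewrite subrK.
move=> /(congr1 modulus_on); rewrite !modulus_onD//; try exact: bpos_ge0.
lra.
Qed.

Lemma modulus_ge0E a : 0 ≼ a -> modulus a = modulus_on a.
Proof.
move=> a0; have := modulus_onZ (lexx 0) (ble_refl 0); rewrite scale0r mul0r => m0.
by rewrite -[a in LHS]subr0 modulusB ?m0 ?subr0//; exact: ble_refl.
Qed.

Lemma modulus_functional : is_functional modulus.
Proof.
have [K K0 fK] := functional_bounded ff.
have mZ (r : R) x : modulus (r *: x) = r * modulus x.
  have [r0|r0] := leP 0 r.
    rewrite -{1}(bpos_subK x) scalerBr modulusB;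
      try by apply: bscale_ge0 => //; exact: bpos_ge0.
    by rewrite !modulus_onZ//; try exact: bpos_ge0; rewrite -mulrBr.
  have r'0 : 0 <= - r by rewrite oppr_ge0 ltW.
  have -> : r *: x = - r *: bpos (- x) - (- r) *: bpos x.
    by rewrite -scalerBr -opprB bpos_subK scalerN scaleNr opprK.
  rewrite modulusB; try by apply: bscale_ge0 => //; exact: bpos_ge0.
  by rewrite !modulus_onZ//; try exact: bpos_ge0; rewrite /modulus; ring.
have mD x y : modulus (x + y) = modulus x + modulus y.
  have -> : x + y = (bpos x + bpos y) - (bpos (- x) + bpos (- y)).
    by rewrite opprD addrACA !bpos_subK.
  rewrite modulusB; try by apply: baddr_ge0; exact: bpos_ge0.
  by rewrite !modulus_onD; try exact: bpos_ge0; rewrite /modulus; ring.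
apply: (@linear_bounded_is_functional _ _ _ (K + K)) => [r x y|x].
  by rewrite mD mZ.
have m_le y : 0 ≼ y -> y ≼ bl_abs x -> `|modulus_on y| <= K * `|x|.
  move=> y0 yx; rewrite ger0_norm.
    apply: modulus_on_le => // z zy.
    apply: le_trans (ler_norm _) _; apply: le_trans (fK z) _.
    apply: ler_wpM2l => //; rewrite -(bnorm_abs x); apply: bnorm_absle.
    exact: ble_trans yx.
  have [f0 _ _ _] := functionalP ff.
  by rewrite -f0; apply: modulus_on_ub; rewrite bge0_abs//; exact: ble_refl.
apply: le_trans (ler_normB _ _) _; rewrite mulrDl; apply: lerD; apply: m_le.
- exact: bpos_ge0.
- exact: bpos_le_abs.
- exact: bpos_ge0.
- by rewrite -babsN; exact: bpos_le_abs.
Qed.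

Lemma modulus_dominates z w : 0 ≼ z -> z ≼ w -> `|f z| <= modulus w.
Proof.
move=> z0 zw; have w0 := ble_trans z0 zw.
have [f0 fD fN fZ] := functionalP ff.
rewrite modulus_ge0E// ler_norml lerNl -fN.
by rewrite !modulus_on_ub// ?babsN bge0_abs.
Qed.

End Modulus.

(** The value of [f] at the infimum of [|x n|] and [u] is dominated by its modulus at [|x n|]. The
    modulus is again a functional, and [|x n|] is weakly null. *)
Lemma weak_null_uaw_null (R : realType) (E : BanachLattice R) (x : nat -> E) :
  weakly_seq_cont_lattice_ops E -> weak_cvg x 0 -> uaw_cvg x 0.
Proof.
move=> latE x0 u u0 f ff; have [f0 _ _ _] := functionalP ff; rewrite f0.
have fm := modulus_functional ff; have [m0 _ _ _] := functionalP fm.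
have := latE x x0 _ fm; rewrite m0 => m_cvg.
apply: norm_cvg0; apply: (squeeze_cvgr _ (cvg_cst 0) m_cvg).
apply: nearW => n; rewrite normr_ge0/= modulus_dominates//.
  by apply: binf_glb => //; exact: babs_ge0.
by apply: ble_trans (binf_lbl _ _) _; rewrite subr0; exact: ble_refl.
Qed.

(** * Weakly null sequences of functionals *)

Section DualSequences.
Context {R : realType}.

(** Evaluation at [x] is a bidual functional, with bound [|x|]. *)
Lemma weak_null_dual_pointwise (X : normedModType R) (g : nat -> X -> R) (x : X) :
  weak_null_dual g -> g ^~ x @ \oo --> (0 : R).
Proof.
move=> [gf /(_ (fun f => f x))]; apply; split => //.
exists `|x|; split => // f K _ _ fK.
by rewrite mulrC; exact: fK.
Qed.

(** Pointwise convergence gives pointwise bounds; Banach-Steinhaus on the complete space [X] makes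
    them uniform on the unit ball. *)
Lemma weak_null_dual_bounded (X : completeNormedModType R) (g : nat -> X -> R) :
  weak_null_dual g -> exists2 C : R, 0 <= C & forall n, dual_bounded (g n) C.
Proof.
move=> g0; have [gf _] := g0.
have [|x|C CP] := @Banach_Steinhauss R X R^o (range g) _ _ 1.
- move=> _ [n _ <-]; split; last by have [] := gf n.
  move=> r; have [K K0 gK] := functional_bounded (gf n).
  exists (K * r) => x xr; apply: le_trans (gK x) _.
  exact: ler_wpM2l.
- have /cvg_seq_bounded gb : cvgn (g ^~ x).
    by apply/cvg_ex; exists 0; exact: weak_null_dual_pointwise.
  near +oo_R => M; exists M => _ [n _ <-].
  have : forall y, [set: nat] y -> `|g y x| <= M by near: M.
  exact.
have {CP} CP n y : `|y| <= 1 -> `|g n y| <= C by apply: CP; exists n.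
exists C => [|n x]; first by apply: le_trans (CP 0%N 0 _); rewrite ?normr0.
have [->|x0] := eqVneq x 0.
  by have [-> _ _ _] := functionalP (gf n); rewrite !normr0 mulr0.
have nx : 0 < `|x| by rewrite normr_gt0.
have := CP n (`|x|^-1 *: x).
have [_ _ _ ->] := functionalP (gf n).
rewrite normrZ normrM normfV normr_id mulVf ?gt_eqF// => /(_ (lexx 1)).
by rewrite ler_pdivrMl// mulrC.
Unshelve. all: by end_near. Qed.

End DualSequences.

(** Uniform convergence to [0] on the order interval from [- v] to [v]: the form in which the
    assumptions on [F] enter. *)
Definition order_equinull {R : realType} {F : BanachLattice R} (g : nat -> F -> R)
    (v : F) : Prop :=
  forall eps : R, 0 < eps ->
    \forall n \near \oo, forall y, bl_abs y ≼ v -> `|g n y| <= eps.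

Lemma positive_op_abs (R : realType) (E F : BanachLattice R) (T : E -> F) (r s : E) :
  is_operator T -> positive_op T -> bl_abs r ≼ s -> bl_abs (T r) ≼ T s.
Proof.
move=> opT posT rs; have [_ TD TN _] := operatorP opT.
apply: babs_le; apply: bsub_ge0; rewrite -!TN -TD; apply: posT;
  apply: bge0_sub; apply: ble_trans rs; [exact: babs_ub|exact: babs_ubN].
Qed.

(* Disjoint bounded sequences are uaw-null, so [T] kills them in the limit and
   [T x] is close to [T y] with [|y| <= u], uniformly on the ball. *)
Lemma uaw_DP_equinull (R : realType) (E F : BanachLattice R) (T : E -> F)
    (x : nat -> E) (M : R) (g : nat -> F -> R) (C : R) :
  is_operator T -> positive_op T -> uaw_DP T -> (forall n, `|x n| <= M) ->
  0 <= C -> (forall n, is_functional (g n)) -> (forall n, dual_bounded (g n) C) ->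
  (forall v, 0 ≼ v -> order_equinull g v) ->
  (fun n => g n (T (x n))) @ \oo --> (0 : R).
Proof.
move=> opT posT uawT xM C0 gf gC gnull.
apply/cvgr0Pnorm_le => eps eps0.
(* Dividing by [C + 1] is safe when [C = 0] and still gives [C * d <= eps / 2]. *)
pose d := eps / 2 / (C + 1).
have d0 : 0 < d by rewrite !divr_gt0//; lra.
have [u u0 uP] : exists2 u, 0 ≼ u &
    forall x, 0 ≼ x -> `|x| <= M -> `|T (bpos (x - u))| <= d.
  apply: disjoint_approx => // v v0 vM vd; apply: uawT; first by exists M.
  exact: disjoint_uaw_null.
have [_ TD _ _] := operatorP opT.
have Tu0 : 0 ≼ T u by exact: posT.
have e20 : 0 < eps / 2 by rewrite divr_gt0.
apply: filterS (gnull _ Tu0 _ e20) => n gn.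
(* This splits [x n] into [y] with [|y| <= u] and a rest that [T] makes small. *)
have : bl_abs (x n) ≼ u + bpos (bl_abs (x n) - u).
  by rewrite addrC; apply: bleBl; exact: bpos_ub.
move=> /(riesz_decomposition u0 (bpos_ge0 _))[y [yu ry]].
rewrite -(subrK y (x n)) TD; have [_ gD _ _] := functionalP (gf n); rewrite gD.
apply: le_trans (ler_normD _ _) _.
rewrite (splitr eps); apply: lerD.
  apply: le_trans (gC n _) _.
  have : `|T (x n - y)| <= d.
    apply: le_trans (uP (bl_abs (x n)) (babs_ge0 _) _); last by rewrite bnorm_abs.
    by apply: bnorm_absle; exact: positive_op_abs.
  rewrite /d ler_pdivlMr; last lra.
  by have := normr_ge0 (T (x n - y)); nra.
by apply: gn; exact: positive_op_abs.
Qed.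

(** * Discrete range *)

Section DiscreteCase.
Context {R : realType} {F : BanachLattice R}.
Variables (g : nat -> F -> R) (C : R).
Hypothesis gf : forall n, is_functional (g n).
Hypothesis gC : forall n, dual_bounded (g n) C.

Lemma order_equinull_mono w w' : w ≼ w' -> order_equinull g w' -> order_equinull g w.
Proof.
move=> ww' gw e e0; apply: filterS (gw e e0) => n gn y yw.
by apply: gn; exact: ble_trans yw ww'.
Qed.

Lemma order_equinullD a b : 0 ≼ a -> 0 ≼ b ->
  order_equinull g a -> order_equinull g b -> order_equinull g (a + b).
Proof.
move=> a0 b0 ga gb e e0; have e20 : 0 < e / 2 by rewrite divr_gt0.
apply: filterS2 (ga _ e20) (gb _ e20) => n gan gbn y yab.
have [y1 [y1a y2b]] := riesz_decomposition a0 b0 yab.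
have [_ gD _ _] := functionalP (gf n).
rewrite -(subrK y1 y) gD (le_trans (ler_normD _ _))// (splitr e) addrC.
by apply: lerD; [exact: gan|exact: gbn].
Qed.

Lemma order_equinull0 : order_equinull g 0.
Proof.
move=> e e0; apply: nearW => n y /bnorm_absle; rewrite normr0 normr_le0 => /eqP ->.
by have [-> _ _ _] := functionalP (gf n); rewrite normr0 ltW.
Qed.

(** Below an atom [y = c a], with [|c| <= 1] by comparing norms, so [|g n y| <= |g n a|]. *)
Lemma atom_order_equinull a : is_atom a -> g ^~ a @ \oo --> (0 : R) ->
  order_equinull g a.
Proof.
move=> [a0 [aN0 a_atom]] ga e e0.
move/cvgr0Pnorm_le : ga => /(_ _ e0); apply: filterS => n gna y ya.
have [c yc] := a_atom y ya.
have [_ _ _ gZ] := functionalP (gf n).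
rewrite yc gZ normrM; apply: le_trans gna; apply: ler_piMl => //.
have := bnorm_absle ya; rewrite yc normrZ -[X in _ <= X]mul1r.
by rewrite ler_pM2r// normr_gt0; apply/eqP.
Qed.

(** The differences [v - w], for [w] between [0] and [v] with the desired property, are directed
    downwards with infimum [0]. Order continuity then makes one of them small in norm. *)
Lemma discrete_order_equinull v : discrete_BL F -> order_continuous_norm F ->
  (forall x, g ^~ x @ \oo --> (0 : R)) -> 0 <= C -> 0 ≼ v -> order_equinull g v.
Proof.
move=> discF ocF g0 C0 v0 e e0.
pose D := [set d | exists w, [/\ 0 ≼ w, w ≼ v, order_equinull g w & d = v - w]].
have C10 : 0 < C + 1 by lra.
have d0 : 0 < e / 2 / (C + 1) by rewrite !divr_gt0.
have [||||_ [w [w0 wv gw ->]] small] := ocF D _ _ _ _ _ d0.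
- by exists (v - 0), 0; split=> //; [exact: ble_refl|exact: order_equinull0].
(* The supremum of [w1] and [w2] is below [w1 + w2], so it keeps the property. *)
- move=> _ _ [w1 [w10 w1v gw1 ->]] [w2 [w20 w2v gw2 ->]].
  exists (v - BL_sup w1 w2).
    exists (BL_sup w1 w2); split=> //.
    + exact: ble_trans w10 (bsup_ubl _ _).
    + exact: bsup_lub.
    + apply: order_equinull_mono (order_equinullD w10 w20 gw1 gw2).
      by apply: bsup_lub; [exact: bleDl|exact: bleDr].
  by split; apply: bleD2l; apply: bleN; [exact: bsup_ubl|exact: bsup_ubr].
- by move=> _ [w [w0 wv gw ->]]; exact: bge0_sub.
(* If [bpos l] is nonzero, take an atom [a] below it. Inductively each [a *+ k] has the property, so
   [a <= v - a *+ k]; all multiples of [a] stay below [v], which the norm forbids. *)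
- move=> l lD; apply: contrapT => l0.
  have pl0 : bpos l <> 0 by move=> pl; apply: l0; rewrite -pl; exact: bpos_ub.
  have [a [atom_a al]] := discF _ (bpos_ge0 l) pl0.
  have [a0 [aN0 _]] := atom_a.
  have ga := atom_order_equinull atom_a (g0 a).
  have ak0 k : 0 ≼ a *+ k.
    by elim: k => [|k IH]; [exact: ble_refl|rewrite mulrSr; exact: baddr_ge0].
  have akv k : a *+ k ≼ v /\ order_equinull g (a *+ k).
    elim: k => [|k [kv gk]]; first by split=> //; exact: order_equinull0.
    rewrite mulrSr; split; last exact: order_equinullD.
    rewrite addrC; apply: bleBr; apply: ble_trans al _.
    apply: bpos_le; last exact: bge0_sub.
    by apply: lD; exists (a *+ k).
  have na : 0 < `|a| by rewrite normr_gt0; apply/eqP.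
  have [kv _] := akv (Num.bound (`|v| / `|a|)).
  have := bnorm_mono (ak0 _) kv; rewrite normrMn -mulr_natl -ler_pdivlMr// leNgt.
  by rewrite archi_boundP// divr_ge0.
have e20 : 0 < e / 2 by rewrite divr_gt0.
apply: filterS (gw _ e20) => n gn y yv.
have {}yv : bl_abs y ≼ w + (v - w) by rewrite addrC subrK.
have [y1 [y1w y2]] := riesz_decomposition w0 (bge0_sub wv) yv.
have [_ gD _ _] := functionalP (gf n).
rewrite -(subrK y1 y) gD (le_trans (ler_normD _ _))// (splitr e).
apply: lerD; last exact: gn.
apply: le_trans (gC n _) _.
have : `|y - y1| < e / 2 / (C + 1) by apply: le_lt_trans small; exact: bnorm_absle.
rewrite ltr_pdivlMr//; have := normr_ge0 (y - y1); nra.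
Qed.

End DiscreteCase.

(** * The space c0 *)

Section c0_space.
Variable R : realType.

(** Boolean, so that [c0] inherits its vector space structure as a subtype of [nat -> R]. *)
Definition null_seq : {pred nat -> R} := fun u => `[< u @ \oo --> (0 : R) >].

Lemma null_seq_submod : submod_closed null_seq.
Proof.
split=> [|a u v /asboolP u0 /asboolP v0]; apply/asboolP; first exact: cvg_cst.
by have := cvgD (cvgMl_tmp (a := a) u0) v0; rewrite mulr0 addr0; apply.
Qed.

HB.instance Definition _ :=
  GRing.isSubmodClosed.Build R (nat -> R) null_seq null_seq_submod.

Record c0 := C0 { c0_val :> nat -> R; _ : c0_val \in null_seq }.

HB.instance Definition _ := [isSub for c0_val].
HB.instance Definition _ := [Choice of c0 by <:].
HB.instance Definition _ := [SubChoice_isSubLmodule of c0 by <:].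

Lemma c0_cvg (u : c0) : (u : nat -> R) @ \oo --> (0 : R).
Proof. by case: u => u /= /asboolP. Qed.

Lemma c0D (u v : c0) n : (u + v) n = u n + v n.
Proof. by []. Qed.

Lemma c0Z (a : R) (u : c0) n : (a *: u) n = a * u n.
Proof. by []. Qed.

Lemma c0B (u v : c0) n : (u - v) n = u n - v n.
Proof. by []. Qed.

Lemma c0_ext (u v : c0) : (forall n, u n = v n) -> u = v.
Proof. by move=> uv; apply: val_inj; apply/funext. Qed.

Definition c0_norm (u : c0) : R := sup (range (fun n => `|u n|)).

Lemma c0_norm_ub (u : c0) n : `|u n| <= c0_norm u.
Proof.
apply: ub_le_sup; last by exists n.
have /cvg_seq_bounded ub : cvgn (u : nat -> R).
  by apply/cvg_ex; exists 0; exact: c0_cvg.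
near +oo_R => M; exists M => _ [k _ <-].
have : forall y, [set: nat] y -> `|u y| <= M by near: M.
exact.
Unshelve. all: by end_near. Qed.

Lemma c0_norm_le (u : c0) c : (forall n, `|u n| <= c) -> c0_norm u <= c.
Proof.
move=> h; apply: ge_sup => [|_ [n _ <-]]; last exact: h.
by exists `|u 0%N|; exists 0%N.
Qed.

Lemma c0_normD (u v : c0) : c0_norm (u + v) <= c0_norm u + c0_norm v.
Proof.
apply: c0_norm_le => n; rewrite c0D; apply: le_trans (ler_normD _ _) _.
by apply: lerD; exact: c0_norm_ub.
Qed.

Lemma c0_normZ (a : R) (u : c0) : c0_norm (a *: u) = `|a| * c0_norm u.
Proof.
have le_Z (b : R) v : c0_norm (b *: v) <= `|b| * c0_norm v.
  by apply: c0_norm_le => n; rewrite c0Z normrM ler_wpM2l// c0_norm_ub.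
apply: le_anti; rewrite le_Z/=.
have [->|a0] := eqVneq a 0.
  by rewrite normr0 mul0r; exact: le_trans (normr_ge0 _) (c0_norm_ub _ 0%N).
rewrite -ler_pdivlMl ?normr_gt0// -normfV.
by apply: le_trans (le_Z _ _); rewrite scalerA mulVf// scale1r.
Qed.

Lemma c0_norm0_eq0 (u : c0) : c0_norm u = 0 -> u = 0.
Proof.
move=> u0; apply: c0_ext => n; apply/eqP; rewrite -normr_le0 -u0.
exact: c0_norm_ub.
Qed.

HB.instance Definition _ :=
  Lmodule_isNormed.Build R c0 c0_normD c0_normZ c0_norm0_eq0.

Lemma c0_coord_le (u : c0) n : `|u n| <= `|u|.
Proof. exact: c0_norm_ub. Qed.

Lemma c0_le_norm (u : c0) c : (forall n, `|u n| <= c) -> `|u| <= c.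
Proof. exact: c0_norm_le. Qed.

(** A Cauchy filter converges in each coordinate and is uniformly close to the coordinatewise limit,
    which is therefore a null sequence. *)
Lemma c0_complete (F : set_system c0) : ProperFilter F -> cauchy F -> cvg F.
Proof.
move=> FF /cauchyP Fc.
have coord_cvg n : cvg ((fun u : c0 => u n) @ F).
  apply: cauchy_cvg; apply/cauchy_exP => e e0.
  have [u0 Fu0] := Fc e e0; exists (u0 n).
  suff : F [set u : c0 | ball (u0 n) e (u n)] by [].
  apply: filterS Fu0 => u /=.
  rewrite -!ball_normE/= => uu; apply: le_lt_trans uu.
  by rewrite -c0B; exact: c0_coord_le.
pose l n := lim ((fun u : c0 => u n) @ F).
have close e : 0 < e -> exists u0 : c0, F (ball u0 e) /\ forall n, `|l n - u0 n| <= e.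
  move=> e0; have [u0 Fu0] := Fc e e0; exists u0; split=> // n.
  have h : (fun u : c0 => `|u n - u0 n|) @ F --> `|l n - u0 n|.
    by apply: cvg_norm; apply: cvgB; [exact: coord_cvg|exact: cvg_cst].
  apply: (cvgr_to_le h); apply: filterS Fu0 => u.
  rewrite -ball_normE/= => uu; apply: le_trans (ltW uu); rewrite distrC.
  by rewrite -c0B; exact: c0_coord_le.
have l0 : l \in null_seq.
  apply/asboolP/cvgr0Pnorm_le => e e0.
  have e20 : 0 < e / 2 by rewrite divr_gt0.
  have [u0 [_ lu0]] := close _ e20.
  have /cvgr0Pnorm_le/(_ _ e20) := c0_cvg u0.
  apply: filterS => n un; rewrite -(subrK (u0 n) (l n)) (splitr e).
  by apply: le_trans (ler_normD _ _) _; exact: lerD.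
apply/cvg_ex; exists (C0 l0); apply/cvgrPdist_le => e e0.
have e20 : 0 < e / 2 by rewrite divr_gt0.
have [u0 [Fu0 lu0]] := close _ e20.
apply: filterS Fu0 => u; rewrite -ball_normE/= => uu.
rewrite (splitr e) -(subrK u0 (C0 l0)) -addrA.
apply: le_trans (ler_normD _ _) _; apply: lerD; last exact: ltW.
exact: c0_le_norm.
Qed.

HB.instance Definition _ := Uniform_isComplete.Build c0 c0_complete.

End c0_space.

(** * Truncations and functionals on [c0] *)

Section c0_dual.
Context {R : realType}.
Implicit Types (u y : c0 R).

Lemma c0_unit_subproof k : (fun n => (n == k)%:R : R) \in @null_seq R.
Proof.
apply/asboolP; apply: cvg_near_cst; exists k.+1 => // n /= kn.
by rewrite gtn_eqF.
Qed.

Definition c0_unit k : c0 R := C0 (c0_unit_subproof k).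

Definition c0_trunc u N : c0 R := \sum_(i < N) u i *: c0_unit i.

Lemma c0_sumE (I : Type) (r : seq I) (P : pred I) (F : I -> c0 R) n :
  (\sum_(i <- r | P i) F i) n = \sum_(i <- r | P i) F i n.
Proof. by elim/big_ind2 : _ => // a b c d <- <-. Qed.

Lemma c0_combE (F : nat -> R) N n :
  (\sum_(i < N) F i *: c0_unit i) n = if (n < N)%N then F n else 0.
Proof.
rewrite c0_sumE -(@big_ord1_eq _ 0 +%R) [RHS]big_mkcond/=; apply: eq_bigr => i _.
by rewrite -[LHS]/(F i * (n == i)%:R) eq_sym; case: ifP; rewrite (mulr1, mulr0).
Qed.

Lemma c0_trunc_cvg u : `|u - c0_trunc u N| @[N --> \oo] --> (0 : R).
Proof.
apply/cvgr0Pnorm_le => e e0.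
have /cvgr0Pnorm_le/(_ _ e0)[N0 _ uN0] := c0_cvg u.
exists N0 => // N /= N0N; rewrite normr_id; apply: c0_le_norm => n.
rewrite c0B c0_combE; case: ltnP => nN; first by rewrite subrr normr0 ltW.
by rewrite subr0; apply: uN0; exact: leq_trans nN.
Qed.

Lemma functional_sum (X : normedModType R) (h : X -> R) (I : Type) (r : seq I)
    (P : pred I) (F : I -> X) : is_functional h ->
  h (\sum_(i <- r | P i) F i) = \sum_(i <- r | P i) h (F i).
Proof.
move=> hf; have [h0 hD _ _] := functionalP hf.
by elim/big_ind2 : _ => // a b c d <- <-.
Qed.

(* The dual of c0 is l1: the coefficients [h (c0_unit i)] are absolutely
   summable, and their tails are the rate [tau]. *)
Lemma c0_functional_tail (h : c0 R -> R) : is_functional h ->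
  exists2 tau : nat -> R, tau @ \oo --> (0 : R) &
    forall N u, `|h (u - c0_trunc u N)| <= tau N * `|u|.
Proof.
move=> hf; have [h0 hD hN hZ] := functionalP hf.
have [K K0 hK] := functional_bounded hf.
pose a i := `|h (c0_unit i)|.
have aK N : \sum_(i < N) a i <= K.
  (* A vector of norm at most [1] at which [h] takes the sum of the [a i]. *)
  pose s : c0 R := \sum_(i < N) Num.sg (h (c0_unit i)) *: c0_unit i.
  have hs : h s = \sum_(i < N) a i.
    by rewrite functional_sum//; apply: eq_bigr => i _; rewrite hZ /a normrEsg.
  rewrite -hs; apply: le_trans (ler_norm _) _; apply: le_trans (hK s) _.
  rewrite -[X in _ <= X]mulr1; apply: ler_wpM2l => //; apply: c0_le_norm => n.
  rewrite (c0_combE (fun i => Num.sg (h (c0_unit i)))).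
  by case: ifP; rewrite ?normr0// normr_sg lern1 leq_b1.
pose A N : R := \sum_(0 <= i < N) a i.
have Amono : {homo A : m n / (m <= n)%N >-> m <= n}.
  by apply: nondecreasing_series => i _ _; exact: normr_ge0.
have Acvg : cvgn A.
  apply: nondecreasing_is_cvgn => //.
  by exists K => _ [N _ <-]; rewrite /A big_mkord.
exists (fun N => limn A - A N).
  rewrite -(subrr (limn A)); apply: cvgB => //; exact: cvg_cst.
move=> N u.
have h_trunc M : h (c0_trunc u M) = \sum_(0 <= i < M) u i * h (c0_unit i).
  by rewrite functional_sum// big_mkord; apply: eq_bigr => i _; rewrite hZ.
(* The tail of [u] is the limit of its sections from [N] to [M], on which [h] is a finite sum. *)
have lim_h : (fun M => `|h (c0_trunc u M) - h (c0_trunc u N)|) @ \oo -->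
    `|h (u - c0_trunc u N)|.
  rewrite hD hN; apply: cvg_norm; apply: cvgB; last exact: cvg_cst.
  apply/cvgrPdist_le => e e0.
  have Ke : 0 < e / (K + 1) by rewrite divr_gt0//; lra.
  have /cvgr0Pnorm_le/(_ _ Ke) := c0_trunc_cvg u.
  apply: filterS => M; rewrite normr_id => uM.
  rewrite -hN -hD; apply: le_trans (hK _) _.
  move: uM; rewrite ler_pdivlMr; last lra.
  by have := normr_ge0 (u - c0_trunc u M); nra.
apply: (cvgr_to_le lim_h); exists N => // M /= NM.
rewrite !h_trunc (big_cat_nat (leq0n N) NM)//= [X in X - _]addrC addrK.
apply: le_trans (ler_norm_sum _ _ _) _.
apply: (@le_trans _ _ ((A M - A N) * `|u|)); last first.
  by apply: ler_wpM2r => //; rewrite lerD2r; exact: nondecreasing_cvgn_le.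
rewrite /A (big_cat_nat (leq0n N) NM)//= [X in X - _]addrC addrK mulr_suml.
apply: ler_sum => i _; rewrite normrM mulrC; apply: ler_wpM2l => //.
exact: c0_coord_le.
Qed.

End c0_dual.

Lemma functional_lincomb {R : realType} (X : normedModType R) (a : R) (f h : X -> R) :
  is_functional f -> is_functional h -> is_functional (fun x => a * f x + h x).
Proof.
move=> ff hf; have [K K0 fK] := functional_bounded ff.
have [L L0 hL] := functional_bounded hf.
apply: (@linear_bounded_is_functional _ _ _ (`|a| * K + L)) => [r x y|x].
  by have [[-> _] [-> _]] := (ff, hf); ring.
apply: le_trans (ler_normD _ _) _; rewrite mulrDl normrM -mulrA.
by apply: lerD; [exact: ler_wpM2l|exact: hL].
Qed.

(** The closed unit ball of the bidual. *)
Definition bidual_contraction {R : realType} {X : normedModType R}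
    (phi : (X -> R) -> R) : Prop :=
  (forall (a : R) (f h : X -> R), is_functional f -> is_functional h ->
     phi (fun x => a * f x + h x) = a * phi f + phi h) /\
  forall (f : X -> R) (K : R), is_functional f -> 0 <= K -> dual_bounded f K ->
    `|phi f| <= K.

(** * The operator into [c0] given by a weakly null sequence of functionals *)

Section DualSequenceOperator.
Context {R : realType} {X : normedModType R}.
Variables (g : nat -> X -> R) (C : R).
Hypothesis g0 : weak_null_dual g.
Hypothesis C_ge0 : 0 <= C.
Hypothesis gC : forall n, dual_bounded (g n) C.

Let gf : forall n, is_functional (g n). Proof. by case: g0. Qed.

Lemma dual_seq_subproof x : (fun n => g n x) \in @null_seq R.
Proof. by apply/asboolP; exact: (weak_null_dual_pointwise x g0). Qed.

Definition dual_seq x : c0 R := C0 (dual_seq_subproof x).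

Lemma dual_seq_bounded x : `|dual_seq x| <= C * `|x|.
Proof. by apply: c0_le_norm => n; exact: gC. Qed.

Lemma dual_seq_operator : is_operator dual_seq.
Proof.
apply: linear_bounded_is_operator dual_seq_bounded => a x y.
by apply: c0_ext => n; have [gL _] := gf n; exact: gL.
Qed.

(** Convergence against the whole bidual is what puts the image of [phi] under the second adjoint of
    [dual_seq] in [c0], not merely among the bounded sequences. *)
Lemma bidual_null_seq phi : bidual_contraction phi ->
  (fun n => phi (g n)) \in @null_seq R.
Proof.
move=> [phiL phiC]; apply/asboolP; have [_] := g0; apply; split=> //.
by exists 1; split=> // f K ff K0 fK; rewrite mul1r; exact: phiC.
Qed.

(** The second adjoint of [dual_seq] sends [phi] to [y]. After truncation only finitely many [g n]
    occur and linearity of [phi] suffices; the tails of [h] are uniformly small on bounded sets. *)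
Lemma bidual_dual_seq phi (h : c0 R -> R) (y : c0 R) : bidual_contraction phi ->
  is_functional h -> (forall n, y n = phi (g n)) -> phi (h \o dual_seq) = h y.
Proof.
move=> [phiL phiC] hf yE; have [h0 hD hN hZ] := functionalP hf.
have [tau tau0 tauP] := c0_functional_tail hf.
have trunc_step u N : h (c0_trunc u N.+1) = h (c0_unit N) * u N + h (c0_trunc u N).
  by rewrite /c0_trunc big_ord_recr/= hD hZ addrC mulrC.
pose q N x := h (c0_trunc (dual_seq x) N).
have qP N : is_functional (q N) /\ phi (q N) = h (c0_trunc y N).
  elim: N => [|N [qf phiq]].
    have -> : q 0%N = fun=> 0 by apply/funext => x; rewrite /q /c0_trunc big_ord0.
    have zf : is_functional (fun=> 0 : R).
      by split=> [a u v|u]; [rewrite mulr0 addr0|exact: cvg_cst].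
    split=> //; rewrite /c0_trunc big_ord0 h0; apply/eqP; rewrite -normr_le0.
    by apply: phiC => // u; rewrite normr0 mul0r.
  have -> : q N.+1 = fun x => h (c0_unit N) * g N x + q N x.
    by apply/funext => x; rewrite /q trunc_step.
  split; first exact: functional_lincomb.
  by rewrite phiL// phiq trunc_step yE.
have hSf := functional_comp dual_seq_operator hf.
(* The term with [C] is the truncation error seen by [phi], the term with [|y|] the error at [y].
   The absolute value keeps the bound passed to [phi] nonnegative. *)
have bound N : `|phi (h \o dual_seq) - h y| <= `|tau N| * (C + `|y|).
  have [qf phiq] := qP N.
  rewrite -(subrK (phi (q N)) (phi _)) -addrA mulrDr.
  apply: le_trans (ler_normD _ _) _; apply: lerD.
    have := phiL (-1) (q N) (h \o dual_seq) qf hSf.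
    rewrite mulN1r addrC => <-; apply: phiC.
    - exact: functional_lincomb.
    - exact: mulr_ge0.
    - move=> x; rewrite mulN1r addrC /= -hN -hD; apply: le_trans (tauP N _) _.
      rewrite -mulrA; apply: le_trans (ler_wpM2r _ (ler_norm _)) _ => //.
      by apply: ler_wpM2l => //; exact: dual_seq_bounded.
  rewrite phiq -normrN opprB -hN -hD; apply: le_trans (tauP N _) _.
  exact: ler_wpM2r (ler_norm _).
apply/eqP; rewrite -subr_eq0 -normr_le0.
have lim0 : (fun N => `|tau N| * (C + `|y|)) @ \oo --> (0 : R).
  rewrite -(mul0r (C + `|y|)); apply: cvgMr_tmp.
  by rewrite -(@normr0 _ R); exact: cvg_norm.
by apply: (cvgr_to_ge lim0); exact: nearW.
Qed.

End DualSequenceOperator.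

(** Compactness of [[-M, M]] provides a cluster point, and an ultrafilter converges to its cluster
    points. *)
Lemma ultra_bounded_cvg (R : realType) (I : Type) (U : set_system I) (u : I -> R)
    (M : R) : UltraFilter U -> U [set i | `|u i| <= M] -> cvg (u @ U).
Proof.
move=> FU UM.
have UMM : (u @ U) `[- M, M]%classic.
  suff : U [set i | `[- M, M]%classic (u i)] by [].
  by apply: filterS UM => i /=; rewrite in_itv/= -ler_norml.
have [p [_ pU]] := @segment_compact R (- M) M (u @ U) _ UMM.
apply/cvg_ex; exists p => A pA.
have [//|UA] := in_ultra_setVsetC (u @^-1` A) FU.
by have [z [zA /zA]] := pU (~` A) A UA pA.
Qed.

(** * Weak compactness in c0 *)

Section WeakTopology.
Context {R : realType} {X : normedModType R}.

Lemma weak_top_functional_continuous (h : X -> R) : is_functional h ->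
  continuous (h : weak_top X -> R).
Proof.
move=> hf y; pose i : dual_sig X := exist _ h hf.
have proj_cont : continuous (fun f : {ptws dual_sig X -> R} => f i).
  move=> f; have /cvg_sup/(_ i) : nbhs f --> (f : {ptws dual_sig X -> R}) by [].
  move=> fi A /(@initial_continuous _ _ (@proj _ (fun=> R) i) f) /fi.
  exact.
have := @initial_continuous _ _ (@dual_eval R X) y.
by move=> /continuous_comp /(_ (proj_cont _)).
Qed.

(** The weak topology is induced from a product, where convergence is coordinatewise. *)
Lemma weak_top_cvg (U : set_system (weak_top X)) (y : weak_top X) : Filter U ->
  (forall h : X -> R, is_functional h -> h @ U --> h y) -> U --> y.
Proof.
move=> FU hU A; rewrite nbhsE => -[_ [[V oV <-] Vy] VA].
apply: filterS VA _.
suff : (@dual_eval R X : weak_top X -> {ptws dual_sig X -> R}) @ U --> dual_eval y.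
  by apply; exact: open_nbhs_nbhs.
apply/cvg_sup => i B; rewrite nbhsE => -[_ [[W oW <-] Wy] WB].
suff UW : U [set z | W (proj1_sig i z)].
  suff : U (@dual_eval R X @^-1` B) by [].
  apply: filterS UW => z Wz.
  exact: (WB (dual_eval z)).
have := hU _ (proj2_sig i) W; apply.
exact: open_nbhs_nbhs.
Qed.

Lemma weak_top_hausdorff :
  (forall x y : X, (forall h, is_functional h -> h x = h y) -> x = y) ->
  hausdorff_space (weak_top X).
Proof.
move=> sep x y xy; apply: sep => h hf.
apply: (@Rhausdorff R) => A B Ax By.
have [z [Az Bz]] := xy _ _ (weak_top_functional_continuous hf Ax)
  (weak_top_functional_continuous hf By).
by exists (h z).
Qed.

End WeakTopology.

Section WeakCompactness.
Context {R : realType} {X : normedModType R}.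
Variables (g : nat -> X -> R) (C : R).
Hypothesis g0 : weak_null_dual g.
Hypothesis C_ge0 : 0 <= C.
Hypothesis gC : forall n, dual_bounded (g n) C.

(** The part in [c0] of the image of the bidual unit ball under the second adjoint; by
    [bidual_null_seq] it is the whole image. *)
Let bidual_image : set (weak_top (c0 R)) :=
  [set y : c0 R | exists phi, bidual_contraction phi /\ forall n, y n = phi (g n)].

(** As in Banach-Alaoglu, functionals chosen for the points converge pointwise along an ultrafilter
    to some [phi] in the unit ball; by [bidual_dual_seq] its image is the weak limit. *)
Lemma bidual_image_compact : compact bidual_image.
Proof.
rewrite compact_ultra => U FU UK.
have [z0 _] := filter_ex UK.
have /choice [Phi PhiP] : forall y : c0 R, exists phi, bidual_image y ->
    bidual_contraction phi /\ forall n, y n = phi (g n).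
  move=> y; have [[phi phiP]|nK] := pselect (bidual_image y); first by exists phi.
  by exists (fun=> 0) => /nK.
pose phi f := lim ((fun y => Phi y f) @ U).
have Phi_cvg f : is_functional f -> (fun y => Phi y f) @ U --> phi f.
  move=> ff; have [K K0 fK] := functional_bounded ff.
  apply: (@ultra_bounded_cvg _ _ _ _ K); apply: filterS UK => y Ky /=.
  by have [[_ +] _] := PhiP y Ky; apply.
have phiC : bidual_contraction phi.
  split=> [a f h ff hf|f K ff K0 fK].
    apply: cvg_lim => //.
    apply: (cvg_trans (near_eq_cvg _)); last first.
      by apply: cvgD (Phi_cvg h hf); apply: cvgMl_tmp (Phi_cvg f ff).
    apply: filterS UK => y Ky; have [[PhiL _] _] := PhiP y Ky.
    by rewrite PhiL.
  apply: (cvgr_to_le (cvg_norm (Phi_cvg f ff))).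
  apply: filterS UK => y Ky; have [[_ +] _] := PhiP y Ky; exact.
pose y : c0 R := C0 (bidual_null_seq g0 phiC).
exists y; split; first by exists phi.
apply: weak_top_cvg => h hf.
rewrite -(bidual_dual_seq g0 C_ge0 gC phiC hf (y := y))//.
have hSf := functional_comp (dual_seq_operator g0 gC) hf.
apply: cvg_trans (Phi_cvg _ hSf); apply: near_eq_cvg.
apply: filterS UK => z Kz; have [PhiC zE] := PhiP z Kz.
exact: (bidual_dual_seq g0 C_ge0 gC PhiC hf zE).
Qed.

(** Evaluations at points of the unit ball put its image inside [bidual_image], which is weakly
    compact and hence weakly closed. *)
Lemma dual_seq_weakly_compact : weakly_compact_op (dual_seq g0).
Proof.
have haus : hausdorff_space (weak_top (c0 R)).
  apply: weak_top_hausdorff => u v uv; apply: c0_ext => n.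
  apply: (uv (fun w : c0 R => w n)).
  apply: (@linear_bounded_is_functional _ _ _ 1) => // w.
  by rewrite mul1r; exact: c0_coord_le.
apply: subclosed_compact bidual_image_compact _; first exact: closed_closure.
have /closure_id -> : closed bidual_image.
  exact: compact_closed haus bidual_image_compact.
apply: closure_subset => _ [x /= x1 <-]; exists (fun f => f x); split=> //.
split=> // f K _ K0 fK; apply: le_trans (fK x) _.
by rewrite -[X in _ <= X]mulr1; exact: ler_wpM2l.
Qed.

End WeakCompactness.

Lemma AM_compact_order_equinull (R : realType) (F : BanachLattice R)
    (g : nat -> F -> R) (C : R) (v : F) :
  AM_compactness_property F -> weak_null_dual g -> 0 <= C ->
  (forall n, dual_bounded (g n) C) -> order_equinull g v.
Proof.
move=> amF g0 C0 gC e e0.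
have cptS : compact (closure (dual_seq g0 @` [set y | bl_abs y ≼ v])).
  apply: (amF _ _ (dual_seq_operator g0 gC) (dual_seq_weakly_compact C0 gC)).
  exists (- v), v => y /= yv; split; last exact: ble_trans (babs_ub y) yv.
  by rewrite -[X in _ ≼ X]opprK; apply: bleN; exact: ble_trans (babs_ubN y) yv.
(* Each point [p] has a ball and a rank beyond which coordinates are at most [e]; compactness makes
   the rank uniform. *)
have /compact_near_coveringP := cptS.
move=> /(_ nat \oo (fun n u => `|u n| <= e) _) cov.
have {}cov : \forall n \near \oo,
    closure (dual_seq g0 @` [set y | bl_abs y ≼ v]) `<=` (fun u => `|u n| <= e).
  apply: cov => p _; have e20 : 0 < e / 2 by rewrite divr_gt0.
  have /cvgr0Pnorm_le/(_ _ e20) pn := c0_cvg p.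
  exists (ball p (e / 2), [set n | `|p n| <= e / 2]).
    by split=> //; exact: nbhsx_ballx.
  move=> [u n] /= [pu {}pn]; rewrite -(subrK (p n) (u n)) (splitr e).
  apply: le_trans (ler_normD _ _) _; apply: lerD => //.
  move: pu; rewrite -ball_normE/= => pu; apply: le_trans (ltW pu).
  by rewrite distrC -c0B; exact: c0_coord_le.
apply: filterS cov => n cov y yv.
by apply: (cov (dual_seq g0 y)); apply: subset_closure; exists y.
Qed.

Theorem theorem4p4 (R : realType) (E F : BanachLattice R) (T : E -> F) :
  is_operator T -> positive_op T -> uaw_DP T ->
  (weakly_seq_cont_lattice_ops E \/
   (discrete_BL F /\ order_continuous_norm F) \/
   AM_compactness_property F) ->
  weak_DP T.
Proof.
move=> opT posT uawT cases x g x0 g0; have [gf _] := g0.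
have [M xM] := weak_null_bounded x0.
have [C C0 gC] := weak_null_dual_bounded g0.
case: cases => [latE|cases]; last first.
  (* Both assumptions on [F] reduce to [order_equinull] for positive [v]. *)
  apply: (uaw_DP_equinull opT posT uawT xM C0 gf gC) => v v0.
  case: cases => [[discF ocF]|amF]; last exact: AM_compact_order_equinull amF g0 C0 gC.
  apply: discrete_order_equinull gf gC _ discF ocF _ C0 v0 => y.
  exact: weak_null_dual_pointwise.
(* Here [x] itself is uaw-null, and the common bound [C] of the [g n] finishes. *)
have Tx0 := uawT x (ex_intro _ M xM) (weak_null_uaw_null latE x0).
apply: norm_cvg0; apply: (squeeze_cvgr _ (cvg_cst 0) (h := fun n => C * `|T (x n)|)).
  by apply: nearW => n; rewrite normr_ge0/=; exact: gC.
by rewrite -(mulr0 C); apply: cvgMl_tmp.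
Qed.
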